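(* Let $m_1,\dots,m_N>0$ with $\sum_{j=1}^Nm_j=1$, let $x_1^0\le x_2^0\le\dots\le x_N^0$, and set $\theta_i=-\frac12+\sum_{j=1}^im_j$ for $i=0,\dots,N$. Let $$M_N^0(x)=-\frac12+\sum_{j=1}^Nm_jH(x-x_j^0),$$ and let $A_N:[-\frac12,\frac12]\to\mathbb R$ be continuous and linear (affine) on each interval $[\theta_{i-1},\theta_i]$, $i=1,\dots,N$. For each $i=1,\dots,N$, let $\psi_i^0$ be the slope of the $i$-th piece of $A_N$, that is, $\psi_i^0=A_N'(m)$ for $\theta_{i-1}<m<\theta_i$, and put $$v_i^0=\psi_i^0-\sum_{j=1}^Nm_j\Phi(x_i^0-x_j^0).$$ Let $(x_i(t),v_i(t))_{i=1}^N$ follow the sticky particle Cucker--Smale dynamics associated to the masses $(m_i)_{i=1}^N$ and the initial conditions $(x_i^0,v_i^0)_{i=1}^N$. Then $$M_N(x,t)=-\frac12+\sum_{i=1}^Nm_iH(x-x_i(t))$$ is an entropy solution of $$\partial_tM_N+\partial_x(A_N(M_N))=(\phi*M_N)\,\partial_xM_N,\qquad M_N(x,0)=M_N^0(x).$$ Moreover, $$A_N\circ M_N(x,t)=A_N(-\tfrac12)+\sum_{i=1}^Nm_i\psi_i(t)H(x-x_i(t)),$$ where $\psi_i(t)=v_i(t)+\sum_{j=1}^Nm_j\Phi(x_i(t)-x_j(t))$.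
   Context: Protocol. $\phi:\mathbb R\to[0,\infty)$ is a fixed communication protocol, nonnegative, locally integrable and radially decreasing (even, and nonincreasing in $|x|$); it may be unbounded near $0$. $\Phi(x)=\int_0^x\phi(y)\,dy$ is its odd antiderivative. $H$ is the right-continuous Heaviside function, $H(0)=1$. Sticky particle Cucker--Smale dynamics. Particles with masses $m_i$, positions $x_i(t)$ (continuous in time) and velocities $v_i(t)$ start from the data $(x_i^0,v_i^0)_{i=1}^N$. Except at times when two or more particles collide, i.e. occupy the same position for the first time, they follow the system $\dot x_i=v_i$, $\dot v_i=\sum_{j:\,x_j\ne x_i}m_j\phi(x_j-x_i)(v_j-v_i)$. Let $J_i(t)=\{j:x_j(t)=x_i(t)\}$. A time $t$ is a collision time if the cardinality of one or more of the $J_i$ increases at time $t$. The collision rules are: collisions are completely inelastic and particles stick together afterwards, $J_i(t)\supseteq J_i(s)$ whenever $t\ge s\ge0$; and collisions conserve momentum, $v_i(t+)=\big(\sum_{j\in J_i(t)}m_jv_j(t-)\big)/\big(\sum_{j\in J_i(t)}m_j\big)$. At collision times the $v_i$ are taken right continuous, $v_i(t)=v_i(t+)$. Particles are indexed from left to right and stay ordered: $x_1(t)\le\dots\le x_N(t)$. Convolution. If $M(\pm x,t)=\pm\frac12$ for all $x\ge R(T)$, $t\in[0,T]$, then for $R\ge R(T)$ and $|x|\le R$, $\phi*M(x,t)=\int_{-2R}^{2R}\phi(z)M(x-z,t)\,dz$. The value does not depend on the choice of $R$ (since $\phi$ is even), so this defines $\phi*M(x,t)$ for all $x\in\mathbb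 R$, $t\in[0,T]$; it is bounded and continuous in $x$ and equals $\Phi*\partial_xM$. Entropy solutions. An entropy/entropy-flux pair for the flux $A$ is a pair $(\eta,q)$ of functions on $[-\frac12,\frac12]$ with $\eta$ convex and Lipschitz and $q'=\eta'A'$. A function $M:\mathbb R\times[0,T]\to[-\frac12,\frac12]$ is an entropy solution of $\partial_tM+\partial_x(A(M))=(\phi*M)\partial_xM$ if: (1) for every such pair, $\partial_t(\eta(M))+\partial_x(q(M))\le(\phi*M)\partial_x(\eta(M))$ in the sense of distributions, i.e. for all nonnegative $\zeta\in C_c^\infty(\mathbb R\times(0,T))$, $\int_0^T\int_{\mathbb R}[\eta(M)\partial_t\zeta+q(M)\partial_x\zeta+\zeta(\phi*M)\partial_x(\eta(M))]\,dx\,dt\ge0$, where $\partial_x(\eta(M))$ is understood as a Radon measure in $x$; (2) $M(\cdot,t)$ is nondecreasing for each $t\in[0,T]$; (3) there is $R(T)>0$ with $M(\pm x,t)=\pm\frac12$ for all $x\ge R(T)$, $t\in[0,T]$. A function $M:\mathbb R\times[0,\infty)\to[-\frac12,\frac12]$ is an entropy solution if its restriction to every compact time interval $[0,T]$ is an entropy solution in this sense.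
   Formalization: Particles starting at the same point are treated as colliding at time 0 (v_i(0) is their momentum average), and it is assumed that v_j^0 ≤ v_i^0 whenever i ≤ j and x_i^0 = x_j^0; otherwise gluing particles with diverging velocities can violate the entropy inequality. *)

(* Defs.v *)
From HB Require Import structures.
From mathcomp Require Import all_boot all_order all_algebra.
From mathcomp Require Import all_classical all_reals all_analysis.

Set Implicit Arguments.
Unset Strict Implicit.
Unset Printing Implicit Defensive.

Import Order.TTheory GRing.Theory Num.Theory.
Import numFieldNormedType.Exports.

Local Open Scope ring_scope.
Local Open Scope classical_set_scope.

(** * Communication protocol *)

(* The monotonicity is only required away from the origin: since [phi 0] is a
   real number, requiring [phi y <= phi 0] would make [phi] bounded. *)
Record protocol (R : realType) (phi : R -> R) : Prop := Protocol {
  protocol_ge0 : forall x, 0 <= phi x;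
  protocol_locint : locally_integrable setT phi;
  protocol_even : forall x, phi (- x) = phi x;
  protocol_decr : forall x y, 0 < `|x| -> `|x| <= `|y| -> phi y <= phi x }.

Definition primitive (R : realType) (phi : R -> R) (x : R) : R :=
  if 0 <= x then \int[lebesgue_measure]_(y in `[0, x]) phi y
  else - \int[lebesgue_measure]_(y in `[x, 0]) phi y.

Definition heaviside (R : realType) (x : R) : R :=
  if 0 <= x then 1 else 0.

(* [phi * M] for a profile [M] with [M (+-x) = +-1/2] for all [x >= R0]. The
   window may be any [ [-2r, 2r] ] with [r >= R0] and [r >= |x|]. *)
Definition convolution (R : realType) (phi : R -> R) (R0 : R) (M : R -> R)
    (x : R) : R :=
  let r := Num.max R0 `|x| in
  \int[lebesgue_measure]_(z in `[- (2 * r), 2 * r]) (phi z * M (x - z)).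

(** * Sticky particle Cucker--Smale dynamics *)

(* Particles are indexed by ['I_N]; [x i t] and [v i t] are only meaningful for
   [0 <= t]. *)

Definition sticky_group (R : realType) (N : nat) (x : 'I_N -> R -> R) (i : 'I_N)
    (t : R) : {set 'I_N} := finset (fun j => x j t == x i t).

Definition collision_time (R : realType) (N : nat) (x : 'I_N -> R -> R)
    (t : R) : Prop :=
  0 < t /\ exists i, forall s, 0 <= s < t ->
    (#|sticky_group x i s| < #|sticky_group x i t|)%N.

Definition alignment_force (R : realType) (N : nat) (phi : R -> R)
    (m : 'I_N -> R) (x v : 'I_N -> R -> R) (i : 'I_N) (t : R) : R :=
  \sum_(j < N | x j t != x i t) m j * phi (x j t - x i t) * (v j t - v i t).

Definition group_average (R : realType) (N : nat) (m : 'I_N -> R)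
    (x : 'I_N -> R -> R) (w : 'I_N -> R) (i : 'I_N) (t : R) : R :=
  (\sum_(j in sticky_group x i t) m j * w j) / (\sum_(j in sticky_group x i t) m j).

(* - [phi] may be discontinuous, so the equation for the velocities is read in
     the sense of Caratheodory on every collision-free time interval ]s, t].
   - Particles with a common initial position collide at time 0. The data [v0]
     are then the velocities [v (0-)] before the collision, as [w] is in
     [sticky_collision], and [v i 0 = v0 i] for a particle that starts alone.
   - At a positive collision time the incoming velocities are automatically
     nonincreasing in the index, because the particles were ordered before.
     [sticky_init_incoming] is this property at time 0. Without it, particles
     that move apart from a common initial position would be glued together,
     which is not entropic: take [phi = 0], masses [1/2, 1/2], [x0 = (0, 0)],
     [v0 = (-1, 1)] and the entropy [eta m = |m|]. *)
Record sticky_dynamics (R : realType) (N : nat) (phi : R -> R)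
    (m x0 v0 : 'I_N -> R) (x v : 'I_N -> R -> R) : Prop := StickyDynamics {
  sticky_init_pos : forall i, x i 0 = x0 i;
  sticky_init_vel : forall i, v i 0 = group_average m x v0 i 0;
  sticky_init_incoming : forall i j : 'I_N,
    (i <= j)%N -> x0 i = x0 j -> v0 j <= v0 i;
  sticky_pos_continuous : forall i, {within `[0, +oo[, continuous (x i)};
  sticky_vel_right_continuous : forall i t, 0 <= t ->
    v i s @[s --> t^'+] --> v i t;
  sticky_pos_ode : forall i t, 0 < t -> ~ collision_time x t ->
    is_derive t (1 : R) (x i) (v i t);
  sticky_vel_ode : forall i s t, 0 <= s <= t ->
    (forall r, s < r <= t -> ~ collision_time x r) ->
    lebesgue_measure.-integrable `[s, t]
      (EFin \o alignment_force phi m x v i) /\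
    v i t = v i s
      + \int[lebesgue_measure]_(r in `[s, t]) alignment_force phi m x v i r;
  sticky_ordered : forall (i j : 'I_N) t,
    (i <= j)%N -> 0 <= t -> x i t <= x j t;
  sticky_sticking : forall i s t, 0 <= s <= t ->
    sticky_group x i s \subset sticky_group x i t;
  sticky_collision : forall t, collision_time x t ->
    exists w : 'I_N -> R, (forall j, v j s @[s --> t^'-] --> w j) /\
      forall i, v i t = group_average m x w i t }.

(** * Test functions *)

Definition test_function (R : realType) (g : R -> R) : Prop :=
  (forall n x, derivable (derive1n n g) x 1) /\
  exists2 K : set R, compact K & forall x, ~ K x -> g x = 0.

Definition dx (R : realType) (f : R -> R -> R) : R -> R -> R :=
  fun x t => derive1 (fun y => f y t) x.

Definition dt (R : realType) (f : R -> R -> R) : R -> R -> R :=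
  fun x t => derive1 (f x) t.

Fixpoint class_C (R : realType) (k : nat) (f : R -> R -> R) : Prop :=
  continuous (fun p : R * R => f p.1 p.2) /\
  if k is k'.+1 then
    [/\ forall x t, derivable (fun y => f y t) x 1,
        forall x t, derivable (f x) t 1,
        class_C k' (dx f) & class_C k' (dt f)]
  else True.

(* Nonnegative elements of C_c^oo(R x (0, T)), extended by 0 to R x R. *)
Definition nonneg_test_function2 (R : realType) (T : R) (zeta : R -> R -> R) :
    Prop :=
  [/\ forall k, class_C k zeta,
      forall x t, 0 <= zeta x t
    & exists K : set (R * R), [/\ compact K,
        K `<=` [set p | 0 < p.2 < T]
      & forall x t, ~ K (x, t) -> zeta x t = 0]].

(** * Entropy solutions *)

(* The signed Radon measure [mu - nu] is the distributional derivative of [u];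
   both measures are finite on compact sets. *)
Definition radon_derivative (R : realType) (u : R -> R)
    (mu nu : {measure set (measurableTypeR R) -> \bar R}) : Prop :=
  (forall K : set R, compact K -> (mu K < +oo)%E /\ (nu K < +oo)%E) /\
  forall g : R -> R, test_function g ->
    \int[lebesgue_measure]_x (u x * derive1 g x) =
    - (\int[mu]_x g x - \int[nu]_x g x).

(* [eta] is only differentiable almost everywhere, so [q' = eta' A'] is read as
   an equality a.e. between the derivatives of Lipschitz functions. *)
Definition entropy_pair (R : realType) (A eta q : R -> R) : Prop :=
  [/\ convex_function (`[- 2^-1, 2^-1] : set R) eta,
      [lipschitz eta m | m in (`[- 2^-1, 2^-1] : set R)],
      [lipschitz q m | m in (`[- 2^-1, 2^-1] : set R)]
    & {ae lebesgue_measure, forall m : R, - 2^-1 < m < 2^-1 ->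
        [/\ derivable eta m 1, derivable A m 1
          & is_derive m (1 : R) q (derive1 eta m * derive1 A m)]}].

(* [d_x (eta o M(., t)) = mu t - nu t] as Radon measures in [x]; [c x t] plays
   the part of [(phi * M) (x, t)]. *)
Definition entropy_production (R : realType) (c : R -> R -> R) (eta q : R -> R) (M : R -> R -> R)
    (mu nu : R -> {measure set (measurableTypeR R) -> \bar R})
    (zeta : R -> R -> R) (t : R) : R :=
  \int[lebesgue_measure]_x (eta (M x t) * dt zeta x t + q (M x t) * dx zeta x t)
  + (\int[mu t]_x (zeta x t * c x t) - \int[nu t]_x (zeta x t * c x t)).

(* Measurability of [M] and integrability in time of the integrand are what
   gives a meaning to the space-time integrals. *)
Definition entropy_solution_on (R : realType) (phi A : R -> R) (T : R)
    (M : R -> R -> R) : Prop :=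
  (forall x t, 0 <= t <= T -> - 2^-1 <= M x t <= 2^-1) /\
  measurable_fun [set p : measurableTypeR R * measurableTypeR R | 0 <= p.2 <= T]
    (fun p => M p.1 p.2 : measurableTypeR R) /\
  exists2 RT : R, 0 < RT &
  [/\ forall eta q : R -> R, entropy_pair A eta q ->
        exists mu nu : R -> {measure set (measurableTypeR R) -> \bar R},
          (forall t, 0 <= t <= T ->
             radon_derivative (fun x => eta (M x t)) (mu t) (nu t)) /\
          forall zeta, nonneg_test_function2 T zeta ->
            let c x t := convolution phi RT (M ^~ t) x in
            lebesgue_measure.-integrable `]0, T[
              (EFin \o entropy_production c eta q M mu nu zeta) /\
            0 <= \int[lebesgue_measure]_(t in `]0, T[)
                   entropy_production c eta q M mu nu zeta t,
      forall t, 0 <= t <= T -> {homo M ^~ t : x y / x <= y}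
    & forall x t, RT <= x -> 0 <= t <= T ->
        M x t = 2^-1 /\ M (- x) t = - 2^-1].

Definition entropy_solution (R : realType) (phi A : R -> R) (M : R -> R -> R) :
    Prop :=
  forall T, 0 < T -> entropy_solution_on phi A T M.

(** * Discretized data *)

Definition theta (R : realType) (N : nat) (m : 'I_N -> R) (k : nat) : R :=
  - 2^-1 + \sum_(j < N | (j < k)%N) m j.

Definition step_profile (R : realType) (N : nat) (m y : 'I_N -> R) (x : R) : R :=
  - 2^-1 + \sum_(j < N) m j * heaviside (x - y j).

(* Main.v *)
Require Import Defs.
From HB Require Import structures.
From mathcomp Require Import all_boot all_order all_algebra.
From mathcomp Require Import all_classical all_reals all_analysis.
From mathcomp Require Import measurable_realfun.
From mathcomp Require Import ring lra.
Import Order.TTheory GRing.Theory Num.Theory.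
Import numFieldNormedType.Exports.
Set Implicit Arguments.
Unset Strict Implicit.
Unset Printing Implicit Defensive.
Local Open Scope ring_scope.
Local Open Scope classical_set_scope.

(** Away from collisions the number [psi i = v i + sum_j m j * Phi (x i - x j)] is
    constant in time, since the alignment force is exactly minus the time
    derivative of the sum; in a collision it is averaged over the new group
    (lemmas [flux_slope_free] and [flux_slope_collision]). At the start it is
    the slope of the [i]-th piece of [A], averaged over the particles that start
    from the same point. So the slopes at a later time are averages of slopes of
    [A] over blocks of consecutive pieces, which are the jumps of the profile: the
    polygon with these slopes meets [A] at the values of the profile, and this is
    the formula for [A] composed with the profile. It also lies below [A] on each
    jump. Indeed particles that collide arrive with slopes that are nonincreasing
    in the index, and replacing a nonincreasing sequence by its average lowers its
    partial sums. Both facts together are [slope_invariant_holds], proved by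
    induction over the collisions.

    For an entropy pair [(eta, q)], the function [eta (M t)] is a step function
    whose jumps [deta i] travel with the particles, and the jumps of [q (M t)] are
    [psi0 i * deta i]. Tested against [zeta], the equation leaves the total time
    derivative of the integral of [eta (M t) * zeta t], which integrates to zero,
    plus the sum of [zeta (x i) * deta i * (psi i - psi0 i)]
    ([production_split]). Abel summation rewrites the latter with the height of
    [A] above the polygon, which is nonnegative, against the increments of the
    slopes of [eta], which are nonnegative by convexity ([dissipation_ge0]).

    The analytic difficulty is that [phi] may jump, and blow up at the origin, so
    [Phi] need not be differentiable along a difference of positions; its
    increments there are computed by [nonincreasing_substitution]. The velocities
    jump at the collision times, which are finitely many, and [FTC_except]
    integrates across them. *)

(** * Averages over groups and Abel summation *)

Lemma sticky_group_mass_gt0 (R : realType) (N : nat) (m : 'I_N -> R)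
    (x : 'I_N -> R -> R) (t : R) (hm : forall i, 0 < m i) (i : 'I_N) :
  0 < \sum_(j in sticky_group x i t) m j.
Proof.
rewrite (bigD1 i) ?inE//=; apply: ltr_pwDl => //.
by apply: sumr_ge0 => j _; exact: ltW.
Qed.

(** Writing the average out turns the prefix sum into a sum of differences
    [u j - u l] over pairs of one group; the pairs inside the prefix cancel by
    antisymmetry, so only those that straddle [k] remain. *)
Lemma prefix_average_defect (R : realType) (N : nat) (m u : 'I_N -> R)
    (x : 'I_N -> R -> R) (t : R) (hm : forall i, 0 < m i) (k : nat) :
  \sum_(j < N | (j < k)%N) m j * (u j - group_average m x u j t) =
  \sum_(j < N | (j < k)%N) \sum_(l < N | (k <= l)%N && (x l t == x j t))
    m j * m l * (u j - u l) / \sum_(i in sticky_group x j t) m i.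
Proof.
pose W j := \sum_(i in sticky_group x j t) m i.
have W0 j : W j != 0 by rewrite gt_eqF// sticky_group_mass_gt0.
pose a j l := m j * m l * (u j - u l) / W j.
have step j : m j * (u j - group_average m x u j t) =
    \sum_(l < N | (k <= l)%N && (x l t == x j t)) a j l
    + \sum_(l < N | (l < k)%N && (x l t == x j t)) a j l.
  have -> : m j * (u j - group_average m x u j t) =
            \sum_(l < N | x l t == x j t) a j l.
    transitivity (m j / W j * (u j * W j -
        \sum_(l in sticky_group x j t) m l * u l)).
      by rewrite /group_average -/(W j); field; exact: W0.
    rewrite /W mulr_sumr -sumrB mulr_sumr; apply: eq_big => l.
      by rewrite inE.
    by move=> _; rewrite /a /W; ring.
  rewrite (bigID (fun l : 'I_N => (k <= l)%N))/=; congr (_ + _).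
    by apply: eq_bigl => l; rewrite andbC.
  by apply: eq_bigl => l; rewrite -ltnNge andbC.
under eq_bigr do rewrite step.
rewrite big_split/= [X in _ + X](_ : _ = 0) ?addr0//.
set S := LHS.
have : S = - S.
  rewrite {1}/S.
  under eq_bigr do rewrite big_mkcondr/=.
  rewrite exchange_big/= /S -sumrN; apply: eq_bigr => j jk.
  rewrite -sumrN big_mkcondr/=; apply: eq_bigr => l lk.
  rewrite eq_sym; case: eqP => // xlj.
  rewrite /a (_ : W l = W j); last first.
    by apply: eq_bigl => i; rewrite !inE xlj.
  by field; exact: W0.
move=> SS; lra.
Qed.

(** Every pair that straddles [k] contributes [u j - u l >= 0]. *)
Lemma prefix_average_ge0 (R : realType) (N : nat) (m u : 'I_N -> R)
    (x : 'I_N -> R -> R) (t : R) (hm : forall i, 0 < m i)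
    (hu : forall i j : 'I_N, (i <= j)%N -> x i t = x j t -> u j <= u i)
    (k : nat) :
  0 <= \sum_(j < N | (j < k)%N) m j * (u j - group_average m x u j t).
Proof.
rewrite prefix_average_defect//; apply: sumr_ge0 => j jk.
apply: sumr_ge0 => l /andP[kl /eqP xlj].
apply: divr_ge0; last exact/ltW/sticky_group_mass_gt0.
apply: mulr_ge0; first by rewrite mulr_ge0// ltW.
by rewrite subr_ge0; apply: hu => //; rewrite (leq_trans (ltnW jk)).
Qed.

(** For sorted [y], these are the [k] for which [theta m k] is a value of the
    step profile of [y]. *)
Definition saturated (R : realType) (N : nat) (y : 'I_N -> R) (k : nat) :=
  forall i j : 'I_N, (i < k <= j)%N -> y j != y i.

Lemma prefix_average_eq0 (R : realType) (N : nat) (m u : 'I_N -> R)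
    (x : 'I_N -> R -> R) (t : R) (hm : forall i, 0 < m i) (k : nat)
    (hk : saturated (x ^~ t) k) :
  \sum_(j < N | (j < k)%N) m j * (u j - group_average m x u j t) = 0.
Proof.
rewrite prefix_average_defect//; apply: big1 => j jk.
by apply: big_pred0 => l; apply: contraTF isT => /andP[kl]; rewrite (negbTE (hk _ _ _))// jk.
Qed.

(** Abel summation, with [D] the partial sums of [d]: the sum of [g i * d i] is
    minus the sum of [D] against the increments of [g], and [D] vanishes wherever
    such an increment may be negative. *)
Lemma abel_le0 (R : realFieldType) (N : nat) (d g : 'I_N -> R)
    (D := fun k : nat => \sum_(j < N | (j < k)%N) d j)
    (hD : forall k, 0 <= D k) (hN : D N = 0)
    (hg : forall i j : 'I_N, j = i.+1 :> nat -> D j = 0 \/ g i <= g j) :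
  \sum_(i < N) g i * d i <= 0.
Proof.
have split (f : 'I_N -> R) (i : 'I_N) :
    \sum_(j < N | (j <= i)%N) f j = \sum_(j < N | (j < i)%N) f j + f i.
  rewrite (bigD1 i)//= addrC; congr (_ + _).
  by apply: eq_bigl => j; rewrite ltn_neqAle andbC.
have key (n : nat) (i : 'I_N) : i = n :> nat ->
    \sum_(j < N | (j <= i)%N) g j * d j <= g i * D i.+1.
  elim: n i => [|n IH] i iE.
    rewrite /D !split !big_pred0; last 2 first.
    - by move=> j; rewrite iE.
    - by move=> j; rewrite iE.
    by rewrite !add0r.
  have nN : (n < N)%N by rewrite ltnW// -iE.
  have prev f : \sum_(j < N | (j < i)%N) f j =
      \sum_(j < N | (j <= Ordinal nN)%N) f j :> R.
    by apply: eq_bigl => j; rewrite iE ltnS.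
  have IHn := IH (Ordinal nN) erefl.
  rewrite split prev /D; rewrite /D in IHn.
  rewrite [X in _ <= g i * X](split d i).
  rewrite mulrDr lerD2r.
  have Dprev : \sum_(j < N | (j < i)%N) d j = \sum_(j < N | (j < (Ordinal nN).+1)%N) d j.
    exact: prev.
  rewrite Dprev.
  apply: le_trans IHn _.
  have [D0|gij] := hg (Ordinal nN) i iE.
    by move: D0; rewrite /D Dprev => ->; rewrite !mulr0.
  by apply: ler_wpM2r => //; exact: hD.
have [N0|N0] := posnP N.
  by rewrite big_pred0// => i; have := ltn_ord i; rewrite {2}N0.
have NP : (N.-1 < N)%N by rewrite prednK.
have := key N.-1 (Ordinal NP) erefl.
rewrite /= prednK// hN mulr0; apply: le_trans.
rewrite le_eqVlt; apply/orP; left; apply/eqP.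
by apply: eq_bigl => j; rewrite -ltnS prednK// ltn_ord.
Qed.

Lemma sorted_le_prefix (R : realType) (N : nat) (y : 'I_N -> R)
    (hy : forall i j : 'I_N, (i <= j)%N -> y i <= y j) (z : R) :
  exists2 k : nat, (k <= N)%N & forall i : 'I_N, (y i <= z) = (i < k)%N.
Proof.
have [h|/existsNP[i0 /negP hi0]] := pselect (forall i, y i <= z).
  by exists N => // i; rewrite h ltn_ord.
have hex : exists k, [exists i : 'I_N, (k == i :> nat) && ~~ (y i <= z)].
  by exists i0; apply/existsP; exists i0; rewrite eqxx.
case: (ex_minnP hex) => k /existsP[i /andP[/eqP -> yi]] kmin.
exists i; first exact: ltnW.
move=> j; case: (ltnP j i) => ij; last first.
  by apply/negbTE; apply: contra yi; apply: le_trans; exact: hy.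
apply: contraLR ij => yj; rewrite -leqNgt; apply: kmin.
by apply/existsP; exists j; rewrite eqxx.
Qed.

Lemma theta0 (R : realType) (N : nat) (m : 'I_N -> R) : theta m 0 = - 2^-1.
Proof. by rewrite /theta big_pred0 ?addr0. Qed.

Lemma thetaS (R : realType) (N : nat) (m : 'I_N -> R) (i : 'I_N) :
  theta m i.+1 = theta m i + m i.
Proof.
rewrite /theta (bigD1 i)//= -addrA; congr (_ + _); rewrite addrC; congr (_ + _).
by apply: eq_bigl => j; rewrite [RHS]ltn_neqAle andbC ltnS.
Qed.

Lemma sum_prefix_telescope (R : realType) (N : nat) (m : 'I_N -> R)
    (F : R -> R) (k : nat) : (k <= N)%N ->
  \sum_(i < N | (i < k)%N) (F (theta m i.+1) - F (theta m i)) =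
  F (theta m k) - F (- 2^-1).
Proof.
move=> kN.
rewrite -(big_ord_widen N (fun i => F (theta m i.+1) - F (theta m i)) kN).
by rewrite -(big_mkord xpredT (fun i => F (theta m i.+1) - F (theta m i)))
  telescope_sumr// theta0.
Qed.

Lemma sum_heaviside (R : realType) (N : nat) (f y : 'I_N -> R) (z : R) (k : nat) :
  (forall i : 'I_N, (y i <= z) = (i < k)%N) ->
  \sum_(i < N) f i * heaviside (z - y i) = \sum_(i < N | (i < k)%N) f i.
Proof.
move=> hk; rewrite [RHS]big_mkcond/=; apply: eq_bigr => i _.
by rewrite /heaviside subr_ge0 hk; case: ifP; rewrite ?mulr1 ?mulr0.
Qed.

(** The sum telescopes over the particles to the left of [z]. Nothing has to
    be known about which of them share a position. *)
Lemma comp_step_profile (R : realType) (N : nat) (m y : 'I_N -> R)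
    (hy : forall i j : 'I_N, (i <= j)%N -> y i <= y j) (F : R -> R) (z : R) :
  F (step_profile m y z) = F (- 2^-1) +
    \sum_(i < N) (F (theta m i.+1) - F (theta m i)) * heaviside (z - y i).
Proof.
have [k kN hk] := sorted_le_prefix hy z.
rewrite /step_profile !(sum_heaviside _ hk)// sum_prefix_telescope//.
by rewrite -/(theta m k) addrC subrK.
Qed.

(** * Fundamental theorems of calculus *)

Lemma Rintegral_FTC2 (R : realType) (f F : R -> R) (a b : R) : a <= b ->
  {within `[a, b], continuous f} -> {within `[a, b], continuous F} ->
  (forall x, a < x < b -> is_derive x (1 : R) F (f x)) ->
  \int[lebesgue_measure]_(x in `[a, b]) f x = F b - F a.
Proof.
rewrite le_eqVlt => /predU1P[->|ab] cf cF dF.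
  by rewrite set_itv1 Rintegral_set1 subrr.
have /(continuous_within_itvP _ ab)[_ Fa Fb] := cF.
rewrite /Rintegral (@continuous_FTC2 R f F a b)//.
- by split => // x; rewrite in_itv/= => xab; case: (dF _ xab).
- by move=> x; rewrite in_itv/= => xab; rewrite derive1E; case: (dF _ xab).
Qed.

Lemma lipschitz_continuous (R : realType) (f : R -> R) (L : R) :
  (forall x y, `|f x - f y| <= L * `|x - y|) -> continuous f.
Proof.
move=> fL x; apply/cvgrPdist_le => e e0.
have L0 : 0 <= L.
  by have := fL 1 0; rewrite subr0 normr1 mulr1; apply: le_trans.
near=> y.
apply: le_trans (fL _ _) _.
apply: (@le_trans _ _ ((L + 1) * `|x - y|)); first by rewrite ler_wpM2r// lerDl.
rewrite -ler_pdivlMl ?ltr_wpDl//.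
near: y; apply: cvgr_dist_le; first exact: cvg_id.
by rewrite mulr_gt0// invr_gt0 ltr_wpDl.
Unshelve. all: by end_near. Qed.

Lemma is_derive_cvgP (R : realType) (f : R -> R) (x d : R) :
  is_derive x (1 : R) f d <->
  h^-1 * (f (x + h) - f x) @[h --> 0^'] --> d.
Proof.
have E : (fun h : R => h^-1 *: ((f \o shift x) (h *: 1) - f x)) =
         (fun h => h^-1 * (f (x + h) - f x)).
  by apply/funext => h /=; rewrite /GRing.scale/= mulr1 [h + x]addrC.
split=> [[df dE]|fd].
  move: df dE; rewrite /derivable /derive E => /cvg_ex[l hl] <-.
  rewrite (_ : lim _ = l)//; last by apply/cvg_lim; [exact: Rhausdorff|exact: hl].
split; rewrite /derivable /derive E; first by apply/cvg_ex; exists d.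
by apply/cvg_lim; [exact: Rhausdorff|exact: fd].
Qed.

Lemma is_derive_derive1 (R : realType) (f : R -> R) (x d : R) :
  derivable f x 1 -> derive1 f x = d -> is_derive x (1 : R) f d.
Proof. by move=> df <-; rewrite derive1E; exact: derivableP. Qed.

Lemma is_derive_cvg_seq (R : realType) (f : R -> R) (x d : R) :
  is_derive x (1 : R) f d ->
  n.+1%:R * (f (x + n.+1%:R^-1) - f x) @[n --> \oo] --> d.
Proof.
move=> /is_derive_cvgP/cvgr_dnbhsP/(_ (fun n => n.+1%:R^-1)).
under [X in _ -> X @ _ --> _]eq_fun do rewrite invrK.
by apply; split => [n|]; [rewrite invr_neq0|exact: cvg_harmonic].
Qed.

(** The difference quotients of a Lipschitz function are dominated by its
    constant, and their integrals are difference quotients, at [a] and [b], of an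
    antiderivative of [f]. So dominated convergence proves the theorem without
    any covering argument. *)
Lemma lipschitz_FTC (R : realType) (f g : R -> R) (a b L : R) : a < b ->
  (forall x y, `|f x - f y| <= L * `|x - y|) ->
  measurable_fun `]a, b[ (g : measurableTypeR R -> measurableTypeR R) ->
  {ae lebesgue_measure, forall x : R, a < x < b -> is_derive x (1 : R) f (g x)} ->
  lebesgue_measure.-integrable `]a, b[ (EFin \o g) /\
  \int[lebesgue_measure]_(x in `]a, b[) g x = f b - f a.
Proof.
move=> ab fL mg aeg.
pose mu := @lebesgue_measure R.
have cf := lipschitz_continuous fL.
have intf c d : mu.-integrable `[c, d] (EFin \o f).
  apply: continuous_compact_integrable; first exact: segment_compact.
  exact: continuous_subspaceT.
pose F x := \int[mu]_(t in `[a - 1, x]) f t.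
have dF x : a - 1 < x -> is_derive x (1 : R) F (f x).
  move=> ax; have [|dFx Fx] := @continuous_FTC1_closed R f (a - 1) x (x + 1) _ (intf _ _) ax (cf x).
    by rewrite ltrDl.
  exact: is_derive_derive1 dFx Fx.
pose q n x := n.+1%:R * (f (x + n.+1%:R^-1) - f x).
have cq n : continuous (q n).
  move=> x; apply: cvgM; first exact: cvg_cst.
  apply: cvgB; last exact: cf.
  apply: (@cvg_comp _ _ _ (fun x => x + n.+1%:R^-1) f); last exact: cf.
  by apply: cvgD; [exact: cvg_id|exact: cvg_cst].
pose G n x := n.+1%:R * (F (x + n.+1%:R^-1) - F x).
have dG n x : a <= x -> is_derive x (1 : R) (G n) (q n x).
  move=> ax.
  have n0 : 0 < n.+1%:R^-1 :> R by rewrite invr_gt0.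
  have ax1 : a - 1 < x by rewrite (lt_le_trans _ ax)// ltrBlDr ltrDl.
  have d1 : is_derive x (1 : R) (F \o (fun x => x + n.+1%:R^-1)) (f (x + n.+1%:R^-1)).
    have dF' : is_derive (x + n.+1%:R^-1) (1 : R) F (f (x + n.+1%:R^-1)).
      by apply: dF; rewrite (lt_trans ax1)// ltrDl.
    by apply: is_derive_eq; rewrite scaler0 addr0 mulr1.
  have d2 : is_derive x (1 : R) F (f x) by apply: dF; lra.
  rewrite /G /q.
  pose proof (is_deriveZ n.+1%:R (is_deriveB d1 d2)) as d3.
  exact: d3.
have mq n : measurable_fun `]a, b[ (q n : measurableTypeR R -> measurableTypeR R).
  apply: measurable_funS (measurableT) _ _ => //.
  exact: continuous_measurable_fun.
have iqn n : mu.-integrable `]a, b[ (EFin \o q n).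
  apply: (@integrableS _ _ _ mu `[a, b]) => //; first exact: subset_itv_oo_cc.
  apply: continuous_compact_integrable; first exact: segment_compact.
  exact: continuous_subspaceT.
have iq n : \int[mu]_(x in `]a, b[) q n x = G n b - G n a.
  transitivity (\int[mu]_(x in `[a, b]) q n x).
    by rewrite /Rintegral [in RHS]integral_itv_bndoo//; exact: (measurable_int mu (iqn n)).
  apply: Rintegral_FTC2 (ltW ab) _ _ _.
  - exact: continuous_subspaceT.
  - apply: derivable_within_continuous => x; rewrite in_itv/= => /andP[ax _].
    by case: (dG n x ax).
  - by move=> x /andP[ax xb]; apply/dG/ltW.
have qL n x : `|q n x| <= L.
  rewrite normrM ger0_norm// -ler_pdivlMl// mulrC.
  by apply: le_trans (fL _ _) _; rewrite addrAC subrr add0r ger0_norm.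
have [ig _ gq] : [/\ mu.-integrable `]a, b[ (EFin \o g), True &
   (fun n => \int[mu]_(x in `]a, b[) (q n x)%:E)%E @ \oo --> (\int[mu]_(x in `]a, b[) (g x)%:E)%E].
  have [] := @dominated_convergence _ _ _ mu `]a, b[ _ (fun n x => (q n x)%:E) (EFin \o g) (fun=> L%:E).
  - by [].
  - by move=> n; exact: (measurable_int mu (iqn n)).
  - exact/measurable_EFinP.
  - move: aeg; apply: filterS; first exact: (ae_filter_ringOfSetsType mu).
    move=> x h; rewrite /= in_itv/= => /h/is_derive_cvg_seq hc.
    by apply: cvg_EFin => //; exact: nearW.
  - apply: (@integrableS _ _ _ mu `[a, b]) => //; first exact: subset_itv_oo_cc.
    apply: (@continuous_compact_integrable R (cst L)); first exact: segment_compact.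
    exact: cst_continuous.
  - by apply: aeW => x n _; rewrite /= lee_fin.
  - by move=> ? _ ?; split.
split => //.
have lim1 : \int[mu]_(x in `]a, b[) q n x @[n --> \oo] --> \int[mu]_(x in `]a, b[) g x.
  by apply: fine_cvg; rewrite fineK//; exact: integrable_fin_num.
have lim2 : \int[mu]_(x in `]a, b[) q n x @[n --> \oo] --> f b - f a.
  under eq_fun do rewrite iq.
  by apply: cvgB; apply: is_derive_cvg_seq; apply: dF; lra.
exact: (cvg_unique _ lim1 lim2).
Qed.

Definition clamp (R : realType) (a b x : R) : R := Num.max a (Num.min b x).

Lemma clamp_itv (R : realType) (a b x : R) : a <= b -> a <= clamp a b x <= b.
Proof.
by move=> ab; rewrite /clamp le_max lexx/= ge_max ab ge_min lexx.
Qed.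

Lemma clamp_id (R : realType) (a b x : R) : a <= x <= b -> clamp a b x = x.
Proof. by move=> /andP[ax xb]; rewrite /clamp min_r// max_r. Qed.

Lemma clamp_left (R : realType) (a b x : R) : x <= a -> clamp a b x = a.
Proof. by move=> xa; rewrite /clamp max_l// ge_min xa orbT. Qed.

Lemma clamp_right (R : realType) (a b x : R) : a <= b -> b <= x -> clamp a b x = b.
Proof. by move=> ab bx; rewrite /clamp min_l// max_r. Qed.

Lemma clamp_lipschitz (R : realType) (a b y z : R) :
  `|clamp a b y - clamp a b z| <= `|y - z|.
Proof.
wlog yz : y z / y <= z => [h|].
  by have [/h//|/ltW/h] := leP y z; rewrite distrC (distrC z).
rewrite (ler0_norm (_ : y - z <= 0)) ?subr_le0// ler_norml /clamp.
by case: (leP b y) => ?; case: (leP b z) => ?; case: (leP a b) => ?;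
  case: (leP a y) => ?; case: (leP a z) => ?; apply/andP; split; lra.
Qed.

Lemma clamp_continuous (R : realType) (a b : R) : continuous (@clamp R a b).
Proof.
move=> x; apply: (@continuous_max R R (cst a) (fun x => Num.min b x)).
  exact: cst_continuous.
by apply: (@continuous_min R R (cst b) id); [exact: cst_continuous|exact: cvg_id].
Qed.

Lemma clamp_comp_continuous (R : realType) (f : R -> R) (a b : R) : a <= b ->
  {within `[a, b], continuous f} -> continuous (f \o clamp a b).
Proof.
move=> ab /subspace_continuousP cf x.
have xab : `[a, b]%classic (clamp a b x) by rewrite /= in_itv/= clamp_itv.
have := cf _ xab => /cvgrPdist_lt cfx.
apply/cvgrPdist_lt => e e0; have {cfx} := cfx _ e0; rewrite near_withinE => h.
have {}h : \forall y \near x, `[a, b]%classic (clamp a b y) ->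
    `|f (clamp a b x) - f (clamp a b y)| < e by exact: (@clamp_continuous R a b x _ h).
near=> y; apply: (near h y) => //.
by rewrite /= in_itv/= clamp_itv.
Unshelve. all: by end_near. Qed.

Lemma clamp_is_derive (R : realType) (f : R -> R) (a b x d : R) : a < x < b ->
  is_derive x (1 : R) f d -> is_derive x (1 : R) (f \o clamp a b) d.
Proof.
move=> xab; apply: (@near_eq_is_derive _ _ _ f).
have xab' : x \in `]a, b[%R by rewrite in_itv.
near=> y; have : y \in `]a, b[%R by near: y; exact: near_in_itvoo.
by rewrite in_itv/= => /andP[ay yb]; rewrite /= clamp_id// !ltW.
Unshelve. all: by end_near. Qed.

(** Each exceptional point splits the interval, and [F] is continuous there. *)
Lemma mean_value_inequality_except (R : realType) (F f : R -> R) (S : seq R)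
    (C a b : R) : a <= b -> {within `[a, b], continuous F} ->
  (forall x, a < x < b -> x \notin S -> is_derive x (1 : R) F (f x) /\ `|f x| <= C) ->
  `|F b - F a| <= C * (b - a).
Proof.
elim: S a b => [|c S IH] a b ab cF dF.
  move: ab; rewrite le_eqVlt => /predU1P[->|ab]; first by rewrite !subrr normr0 mulr0.
  have dF' x : x \in `]a, b[%R -> is_derive x 1 F (f x).
    by rewrite in_itv/= => xab; have [] := dF x xab isT.
  have [x xab ->] := MVT ab dF' cF.
  move: xab; rewrite in_itv/= => xab; have [_ fC] := dF x xab isT.
  by rewrite normrM (@gtr0_norm _ (b - a)) ?subr_gt0// ler_pM2r ?subr_gt0.
have [/andP[ac cb]|ncab] := boolP (a < c < b); last first.
  apply: IH => // x xab xS; apply: dF => //; rewrite inE negb_or xS andbT.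
  by apply: contraNneq ncab => <-.
rewrite -(subrKA (F c)) -(subrKA c (b) (- a)) mulrDr.
apply: le_trans (ler_normD _ _) _; apply: lerD.
- apply: IH; first exact: ltW.
    apply: continuous_subspaceW cF; apply: subset_itvr; rewrite bnd_simp; exact: ltW.
  move=> x /andP[cx xb] xS; apply: dF; first by rewrite (lt_trans ac).
  by rewrite inE negb_or xS gt_eqF.
- apply: IH; first exact: ltW.
    apply: continuous_subspaceW cF; apply: subset_itvl; rewrite bnd_simp; exact: ltW.
  move=> x /andP[ax xc] xS; apply: dF; first by rewrite ax (lt_trans xc).
  by rewrite inE negb_or xS lt_eqF.
Qed.

(** Away from the exceptional points [f] is a limit of difference quotients. *)
Lemma derivative_measurable_except (R : realType) (F f : R -> R) (S : seq R)
    (a b : R) : a < b -> {within `[a, b], continuous F} ->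
  (forall x, a < x < b -> x \notin S -> is_derive x (1 : R) F (f x)) ->
  measurable_fun `]a, b[ (f : measurableTypeR R -> measurableTypeR R).
Proof.
move=> ab cF dF; pose Fc := F \o clamp a b.
have cFc : continuous Fc by apply: clamp_comp_continuous => //; exact: ltW.
have mS : measurable ([set` S] : set (measurableTypeR R)).
  by apply: countable_measurable => [t|]; [exact: measurable_set1|exact/finite_set_countable/finite_seq].
have mI : measurable (`]a, b[%classic : set (measurableTypeR R)) by exact: measurable_itv.
rewrite -(setUIDK `]a, b[%classic [set` S]).
apply/measurable_funU => //; first exact: measurableI.
  exact: measurableD.
split.
  move=> _ Y mY; apply: countable_measurable => [t|]; first exact: measurable_set1.
  apply: (@sub_countable _ _ _ [set` S]); last exact/finite_set_countable/finite_seq.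
  by apply: subset_card_le => x [[]].
pose q n x := n.+1%:R * (Fc (x + n.+1%:R^-1) - Fc x).
apply: (@measurable_fun_cvg _ _ _ _ q).
  move=> n; apply: measurable_funTS; apply: continuous_measurable_fun => x.
  apply: cvgM; first exact: cvg_cst.
  apply: cvgB; last exact: cFc.
  apply: (@cvg_comp _ _ _ (fun x => x + n.+1%:R^-1) Fc); last exact: cFc.
  by apply: cvgD; [exact: cvg_id|exact: cvg_cst].
move=> x [/=]; rewrite in_itv/= => xab /negP xS.
by apply/is_derive_cvg_seq/clamp_is_derive => //; exact: dF.
Qed.

(** This is what integrates over all collisions at once: [F] clamped to
    [[a, b]] is Lipschitz by the mean value inequality. *)
Lemma FTC_except (R : realType) (F f : R -> R) (S : seq R) (C a b : R) : a < b ->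
  {within `[a, b], continuous F} ->
  (forall x, a < x < b -> x \notin S -> is_derive x (1 : R) F (f x) /\ `|f x| <= C) ->
  lebesgue_measure.-integrable `]a, b[ (EFin \o f) /\
  \int[lebesgue_measure]_(x in `]a, b[) f x = F b - F a.
Proof.
move=> ab cF dF.
have mf := derivative_measurable_except ab cF (fun x xab xS => (dF x xab xS).1).
have Fab : F b - F a = (F \o clamp a b) b - (F \o clamp a b) a.
  by rewrite /= !clamp_id// ?lexx ?ltW.
rewrite Fab; apply: (@lipschitz_FTC R (F \o clamp a b) f a b (Num.max C 0)) => //.
  have key x y : x <= y ->
      `|(F \o clamp a b) y - (F \o clamp a b) x| <= Num.max C 0 * (y - x).
    move=> xy; apply: (@mean_value_inequality_except _ _
      (fun z => if a < z < b then f z else 0) (a :: b :: S)) => //.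
      exact/continuous_subspaceT/clamp_comp_continuous/cF/ltW.
    move=> z _; rewrite !inE !negb_or => /and3P[za zb zS].
    case: ifPn => [zab|].
      have [dFz fC] := dF z zab zS; split; first exact: clamp_is_derive.
      by rewrite le_max fC.
    rewrite normr0 le_max lexx orbT negb_and -!leNgt => zab; split => //.
    apply: (@near_eq_is_derive _ _ _ (cst (F (clamp a b z)))).
    have [za'|bz] : z < a \/ b < z.
      by move: za zb zab; case: (ltgtP z a); case: (ltgtP z b) => //; auto.
      near=> u; rewrite /= !clamp_left ?ltW//.
      by near: u; exact: lt_nbhsl.
    near=> u; rewrite /= !clamp_right ?ltW//.
    by near: u; exact: lt_nbhsr.
  move=> x y; wlog xy : x y / y <= x => [h|].
    have [/h//|/ltW/h] := leP y x; rewrite distrC (distrC y) => h2; exact: h2.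
  by rewrite (ger0_norm (_ : 0 <= x - y)) ?subr_ge0// key.
have [N [mN N0 SN]] : lebesgue_measure.-negligible [set` S].
  exists [set` S]; split => //.
    by apply: countable_measurable => [t|]; [exact: measurable_set1|exact/finite_set_countable/finite_seq].
  exact/countable_lebesgue_measure0/finite_set_countable/finite_seq.
exists N; split => // x /=.
move=> /not_implyP[xab ndF]; apply: SN => /=; apply: contra_notT ndF => xS.
by apply: clamp_is_derive => //; have [] := dF x xab xS.
Unshelve. all: by end_near. Qed.

(** * Primitives and substitution along a path *)

Definition integrable_on_segments (R : realType) (h : R -> R) :=
  forall a b : R, lebesgue_measure.-integrable `[a, b] (EFin \o h).

Lemma continuous_integrable_on_segments (R : realType) (h : R -> R) :
  continuous h -> integrable_on_segments h.
Proof.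
move=> ch a b; apply: continuous_compact_integrable; first exact: segment_compact.
exact: continuous_subspaceT.
Qed.

Lemma bounded_integrable_segment (R : realType) (h : R -> R) (C a b : R) :
  measurable_fun `[a, b] (h : measurableTypeR R -> measurableTypeR R) ->
  (forall x, a <= x <= b -> `|h x| <= C) ->
  lebesgue_measure.-integrable `[a, b] (EFin \o h).
Proof.
move=> mh hC; apply: measurable_bounded_integrable => //.
  exact: compact_finite_measure (@segment_compact _ _ _).
exists C; split; first exact: num_real.
by move=> M CM x /=; rewrite in_itv/= => /hC/le_trans; apply; exact: ltW.
Qed.

Lemma Rintegral_bounded_cvg (R : realType) (h_ : nat -> R -> R) (h : R -> R)
    (C a b : R) :
  (forall n, measurable_fun `[a, b] (h_ n : measurableTypeR R -> measurableTypeR R)) ->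
  (forall n x, a <= x <= b -> `|h_ n x| <= C) ->
  (forall x, a <= x <= b -> h_ n x @[n --> \oo] --> h x) ->
  lebesgue_measure.-integrable `[a, b] (EFin \o h) /\
  \int[lebesgue_measure]_(x in `[a, b]) h_ n x @[n --> \oo] -->
    \int[lebesgue_measure]_(x in `[a, b]) h x.
Proof.
move=> mh hC hh; pose mu := @lebesgue_measure R.
have mh0 : measurable_fun `[a, b] (h : measurableTypeR R -> measurableTypeR R).
  by apply: (measurable_fun_cvg mh) => x; rewrite /= in_itv/= => /hh.
have ih : mu.-integrable `[a, b] (EFin \o h).
  apply: (@bounded_integrable_segment _ _ C) => // x xab.
  have : `|h_ n x| @[n --> \oo] --> `|h x| by apply: cvg_norm; exact: hh.
  by move=> /cvgr_to_le; apply; apply: nearW => n; exact: hC.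
split => //.
have iC : mu.-integrable `[a, b] (fun=> C%:E).
  apply: (@continuous_compact_integrable R (cst C)); first exact: segment_compact.
  exact: cst_continuous.
apply: fine_cvg; rewrite fineK; last exact: integrable_fin_num.
apply: (@dominated_cvg _ _ _ mu `[a, b] _ (fun n x => (h_ n x)%:E) (EFin \o h) (fun=> C%:E)) => //.
- by move=> n; apply: measurableT_comp => //; exact: mh.
- move=> x; rewrite /= in_itv/= => xab.
  by apply: cvg_EFin; [exact: nearW|exact: hh].
Qed.

Lemma Rintegral_segment_split (R : realType) (h : R -> R) (a b c : R) :
  integrable_on_segments h -> a <= c -> c <= b ->
  \int[lebesgue_measure]_(x in `[a, b]) h x =
  \int[lebesgue_measure]_(x in `[a, c]) h x +
  \int[lebesgue_measure]_(x in `[c, b]) h x.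
Proof.
move=> ih ac cb.
have := @Rintegral_itvB R h (BLeft a) (BRight b) c (ih a b).
rewrite !bnd_simp => /(_ ac cb).
rewrite Rintegral_itv_obnd_cbnd; last first.
  by apply: integrableS (ih c b) => //; exact: subset_itv_oc_cc.
by move=> <-; rewrite addrC subrK.
Qed.

Lemma primitiveB (R : realType) (h : R -> R) (a b : R) :
  integrable_on_segments h -> a <= b ->
  primitive h b - primitive h a = \int[lebesgue_measure]_(x in `[a, b]) h x.
Proof.
move=> ih ab; rewrite /primitive.
have [b0|b0] := leP 0 b; have [a0|a0] := leP 0 a.
- by rewrite (Rintegral_segment_split ih a0 ab) addrAC subrr add0r.
- by rewrite (Rintegral_segment_split ih (ltW a0) b0) opprK addrC.
- by have := lt_le_trans b0 a0; rewrite ltNge ab.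
- by rewrite (Rintegral_segment_split ih ab (ltW b0)) opprK addrC addrK.
Qed.

Lemma primitive_continuous (R : realType) (h : R -> R) :
  integrable_on_segments h -> continuous (primitive h).
Proof.
move=> ih x.
have xlt : x - 1 < x + 1 by lra.
have := @parameterized_integral_continuous R (x - 1) (x + 1) h (ltW xlt) (ih _ _).
move=> /(continuous_within_itvP _ xlt)[+ _ _] => /(_ x).
have xin : x \in `](x - 1), (x + 1)[%R by rewrite in_itv/=; apply/andP; split; lra.
move=> /(_ xin) cx.
have xgt : x - 1 < x by rewrite ltrBlDr ltrDl.
have E z : x - 1 <= z -> primitive h (x - 1) +
    parameterized_integral lebesgue_measure (x - 1) z h = primitive h z.
  by move=> xz; rewrite /parameterized_integral -primitiveB// addrC subrK.
have H : primitive h (x - 1) + parameterized_integral lebesgue_measure (x - 1) z h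
    @[z --> x] --> primitive h x.
  by rewrite -(E x (ltW xgt)); apply: cvgD cx; exact: cvg_cst.
apply: cvg_trans H; apply: near_eq_cvg; near=> z; rewrite E//.
by apply: ltW; near: z; exact: lt_nbhsr.
Unshelve. all: by end_near. Qed.

Lemma primitive_is_derive (R : realType) (h : R -> R) (x : R) :
  continuous h -> is_derive x (1 : R) (primitive h) (h x).
Proof.
move=> ch; have ih := continuous_integrable_on_segments ch.
have xlt : x < x + 1 by rewrite ltrDl.
have xgt : x - 1 < x by rewrite ltrBlDr ltrDl.
have [dI I'] := @continuous_FTC1_closed R h (x - 1) x (x + 1) xlt (ih _ _) xgt (ch x).
pose I z := \int[lebesgue_measure]_(t in `[x - 1, z]) h t.
have dI2 : is_derive x (1 : R) I (h x) := is_derive_derive1 dI I'.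
have dI3 : is_derive x (1 : R) (fun z => primitive h (x - 1) + I z) (h x).
  have := is_deriveD (is_derive_cst (primitive h (x - 1)) x (1 : R)) dI2.
  by rewrite add0r.
apply: near_eq_is_derive dI3; near=> z.
rewrite /I -primitiveB//; first by rewrite addrC subrK.
by apply: ltW; near: z; exact: lt_nbhsr.
Unshelve. all: by end_near. Qed.

(** [h] may be discontinuous, so the substitution [z -> - z] is made with the
    invariance of the Lebesgue measure. *)
Lemma primitive_odd (R : realType) (h : R -> R) :
  (forall x, 0 <= h x) -> measurable_fun setT (h : measurableTypeR R -> measurableTypeR R) ->
  (forall x, h (- x) = h x) -> forall x, primitive h (- x) = - primitive h x.
Proof.
move=> h0 mh hN.
have key x : 0 < x -> \int[lebesgue_measure]_(y in `[- x, 0]) h y =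
    \int[lebesgue_measure]_(y in `[0, x]) h y.
  move=> x0; rewrite /Rintegral; congr fine.
  pose f := (EFin \o h) \_ `[- x, x].
  have mf : measurable_fun setT f.
    by apply/(measurable_restrictT _ _).1 => //; apply/measurable_EFinP; exact: measurable_funTS.
  have f0 r : (0 <= f r)%E by rewrite /f patchE; case: ifP => // _; rewrite lee_fin.
  have fN r : f (- r)%R = f r.
    rewrite /f !patchE /= hN; congr (if _ then _ else _).
    by apply/idP/idP; rewrite !inE/= !in_itv/= => /andP[? ?]; apply/andP; split; lra.
  have := ge0_integration_by_substitution0 mf f0.
  under [X in _ = X -> _]eq_integral do rewrite fN.
  rewrite /f -!integral_mkcondr.
  rewrite (_ : `[0, +oo[ `&` `[- x, x] = `[0, x]); last first.
    apply/seteqP; split=> y /=; rewrite !in_itv/= ?andbT.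
      by move=> [-> /andP[_ ->]].
    by move=> /andP[y0 yx]; split => //; apply/andP; split => //; lra.
  rewrite (_ : `]-oo, 0] `&` `[- x, x] = `[- x, 0]); last first.
    apply/seteqP; split=> y /=; rewrite !in_itv/=.
      by move=> [-> /andP[-> _]].
    by move=> /andP[y0 yx]; split => //; apply/andP; split => //; lra.
  by move=> ->.
move=> x; rewrite /primitive oppr_ge0; case: (ltgtP x 0) => [x0|x0|->].
- by rewrite opprK; have := key (- x); rewrite opprK oppr_gt0 => /(_ x0) ->.
- by rewrite key.
- by rewrite oppr0 set_itv1 Rintegral_set1 oppr0.
Qed.

Lemma cvg_rsum (R : realType) (I T : Type) (F : set_system T) (FF : Filter F)
    (r : seq I) (P : pred I) (f : I -> T -> R) (l : I -> R) :
  (forall i, P i -> f i x @[x --> F] --> l i) ->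
  \sum_(i <- r | P i) f i x @[x --> F] --> \sum_(i <- r | P i) l i.
Proof. by move=> fl; apply: cvg_big => //; exact: add_continuous. Qed.

Lemma continuous_segment_bounded (R : realType) (f : R -> R) (a b : R) :
  continuous f -> exists C, forall x, a <= x <= b -> `|f x| <= C.
Proof.
move=> cf; have [ab|ba] := leP a b; last first.
  by exists 0 => x /andP[ax xb]; have := le_trans ax xb; rewrite leNgt ba.
have cn : {within `[a, b], continuous (fun x => `|f x|)}.
  by apply: continuous_subspaceT => x; apply: cvg_norm; exact: cf.
have [c _ hc] := EVT_max ab cn.
by exists `|f c| => x xab; apply: hc; rewrite in_itv.
Qed.

(** The slope of the approximants grows while their value at the end point of
    the ray stays the value of the indicator there; this gives convergence at
    every point, not almost everywhere. A path may spend a positive time at the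
    end point. *)
Lemma ray_indicator_limit (R : realType) (I : R -> bool) :
  (forall x y, x <= y -> I y -> I x) ->
  exists rho : nat -> R -> R, [/\ forall n, continuous (rho n),
    forall n x, 0 <= rho n x <= 1
  & forall x, rho n x @[n --> \oo] --> ((I x)%:R : R)].
Proof.
move=> dI.
have [I1|/existsNP[b /negP Ib]] := pselect (forall x, I x).
  exists (fun _ => cst 1); split=> [n|n x|x]; first exact: cst_continuous.
    by rewrite ler01 lexx.
  by rewrite I1; exact: cvg_cst.
have [I0|/existsNP[a /negP/negPn Ia]] := pselect (forall x, ~~ I x).
  exists (fun _ => cst 0); split=> [n|n x|x]; first exact: cst_continuous.
    by rewrite lexx ler01.
  by rewrite (negbTE (I0 x)); exact: cvg_cst.
have ubI : has_ubound [set x | I x].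
  exists b => x /= Ix; rewrite leNgt; apply: contra Ib => bx.
  apply: dI Ix; exact: ltW.
pose l := sup [set x | I x].
have belowl x : x < l -> I x.
  by move=> /(sup_gt (ex_intro _ a Ia))[y /= Iy /ltW xy]; exact: dI Iy.
have abovel x : l < x -> I x = false.
  move=> lx; apply/negbTE/negP => Ix; move: lx; rewrite ltNge => /negP; apply.
  exact: (ub_le_sup ubI Ix).
exists (fun n x => clamp 0 1 ((I l)%:R + n%:R * (l - x))); split.
- move=> n x; apply: (@cvg_comp _ _ _ (fun x => (I l)%:R + n%:R * (l - x)) (clamp 0 1)); last exact: clamp_continuous.
  apply: cvgD; first exact: cvg_cst.
  apply: cvgM; first exact: cvg_cst.
  by apply: cvgB; [exact: cvg_cst|exact: cvg_id].
- by move=> n x; exact: clamp_itv.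
- move=> x; have [xl|lx|->] := ltgtP x l; last first.
  + under eq_fun do rewrite subrr mulr0 addr0 clamp_id ?ler0n ?lern1 ?leq_b1//.
    exact: cvg_cst.
  + rewrite (abovel x lx); apply: cvg_near_cst; near=> n; rewrite clamp_left//.
    rewrite -lerBrDl sub0r -lerNr -mulrN opprB -ler_pdivrMr ?subr_gt0//.
    by near: n; exact: nbhs_infty_ger.
  + rewrite (belowl x xl); apply: cvg_near_cst; near=> n; rewrite clamp_right//.
    apply: (@le_trans _ _ (n%:R * (l - x))); last by rewrite lerDr.
    rewrite -ler_pdivrMr ?subr_gt0//.
    by near: n; exact: nbhs_infty_ger.
Unshelve. all: by end_near. Qed.

Lemma sum_levels (R : realType) (n : nat) (u : R) : 0 <= u <= n%:R ->
  \sum_(k < n) ((k.+1%:R <= u)%R%:R : R) = (Num.truncn u)%:R.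
Proof.
move=> /andP[u0 un].
have un' : (Num.truncn u <= n)%N.
  by rewrite -(@ler_nat R); apply: le_trans un; rewrite truncn_le.
under eq_bigr do rewrite -truncn_gt_nat.
rewrite -natr_sum -big_mkcond/= -(big_ord_widen n (fun=> 1%N) un').
by rewrite sum1_card card_ord.
Qed.

Section substitution.
Context (R : realType) (y w : R -> R) (s t : R).
Hypotheses (st : s <= t) (cy : continuous y) (cw : continuous w).
Hypothesis dy : forall r, s < r < t -> is_derive r (1 : R) y (w r).

Let substitutes (h : R -> R) :=
  \int[lebesgue_measure]_(r in `[s, t]) (h (y r) * w r) =
  primitive h (y t) - primitive h (y s).

Let continuous_substitutes (h : R -> R) : continuous h -> substitutes h.
Proof.
move=> ch; apply: (@Rintegral_FTC2 R (fun r => h (y r) * w r) (primitive h \o y)) => //.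
- apply: continuous_subspaceT => r; apply: cvgM; last exact: cw.
  by apply: (@cvg_comp _ _ _ y h); [exact: cy|exact: ch].
- apply: continuous_subspaceT => r; apply: (@cvg_comp _ _ _ y (primitive h)).
    exact: cy.
  exact/primitive_continuous/continuous_integrable_on_segments.
- by move=> r rst; apply: is_derive1_comp; [exact: primitive_is_derive|exact: dy].
Qed.

Let limit_substitutes (h_ : nat -> R -> R) (h : R -> R) (C : R) :
  (forall n, measurable_fun setT (h_ n : measurableTypeR R -> measurableTypeR R)) ->
  (forall n x, `|h_ n x| <= C) -> (forall x, h_ n x @[n --> \oo] --> h x) ->
  (forall n, substitutes (h_ n)) -> substitutes h.
Proof.
move=> mh hC hh sh.
have [W Wb] := continuous_segment_bounded s t cw.
have L : \int[lebesgue_measure]_(r in `[s, t]) (h_ n (y r) * w r) @[n --> \oo] -->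
    \int[lebesgue_measure]_(r in `[s, t]) (h (y r) * w r).
  apply: (@Rintegral_bounded_cvg R (fun n r => h_ n (y r) * w r)
    (fun r => h (y r) * w r) (C * W) s t _ _ _).2.
  - move=> n; apply: measurable_funM; last first.
      by apply: measurable_funTS; exact: continuous_measurable_fun.
    apply: measurable_funTS; apply: measurableT_comp; first exact: mh.
    exact: continuous_measurable_fun.
  - move=> n r rst; rewrite normrM; apply: ler_pM => //; exact: Wb.
  - by move=> r _; apply: cvgM; [exact: hh|exact: cvg_cst].
have cvgP z : primitive (h_ n) z @[n --> \oo] --> primitive h z.
  rewrite /primitive; case: ifPn => _.
    by apply: (@Rintegral_bounded_cvg R h_ h C 0 z _ _ _).2 => // n; exact: (measurable_funTS (mh n)).
  by apply: cvgN; apply: (@Rintegral_bounded_cvg R h_ h C z 0 _ _ _).2 => // n; exact: (measurable_funTS (mh n)).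
have L2 : \int[lebesgue_measure]_(r in `[s, t]) (h_ n (y r) * w r) @[n --> \oo] -->
    primitive h (y t) - primitive h (y s).
  under eq_fun do rewrite sh.
  by apply: cvgB; exact: cvgP.
exact: (cvg_unique _ L L2).
Qed.

(** The path [y] need not be monotone and [h] may jump, so neither the chain rule
    nor a monotone change of variables applies. The formula holds for continuous
    [h] and passes to bounded pointwise limits. The level sets of a nonincreasing
    [h] are rays, whose indicators are limits of continuous functions, and [h] is
    a uniform limit of combinations of these indicators. *)
Lemma nonincreasing_substitution (h : R -> R) (C : R) :
  {homo h : a b /~ a <= b} -> (forall x, 0 <= h x <= C) ->
  lebesgue_measure.-integrable `[s, t] (EFin \o (fun r => h (y r) * w r)) /\
  \int[lebesgue_measure]_(r in `[s, t]) (h (y r) * w r) =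
  primitive h (y t) - primitive h (y s).
Proof.
move=> hd hC.
have mh : measurable_fun setT (h : measurableTypeR R -> measurableTypeR R).
  by apply: nonincreasing_measurable => // a b ab; exact: hd.
split.
  have [W Wb] := continuous_segment_bounded s t cw.
  apply: (@bounded_integrable_segment _ _ (C * W)).
    apply: measurable_funM; last first.
      by apply: measurable_funTS; exact: continuous_measurable_fun.
    apply: measurable_funTS; apply: measurableT_comp; first exact: mh.
    exact: continuous_measurable_fun.
  move=> r rst; rewrite normrM; apply: ler_pM => //; last exact: Wb.
  by have /andP[h0 hC'] := hC (y r); rewrite ger0_norm.
pose D := C + 1.
have D0 : 0 < D.
  by have /andP[h0 hC'] := hC 0; rewrite /D ltr_pwDr// (le_trans h0).
pose lev n k x := (k.+1%:R <= h x * n.+1%:R / D)%R.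
pose h_ n x := D / n.+1%:R * \sum_(k < n.+1) ((lev n k x)%:R : R).
have h_E n x : h_ n x = D / n.+1%:R * (Num.truncn (h x * n.+1%:R / D))%:R.
  rewrite /h_ sum_levels//; have /andP[h0 hC'] := hC x.
  apply/andP; split; first by rewrite divr_ge0 ?mulr_ge0// ltW.
  by rewrite ler_pdivrMr// mulrC ler_wpM2l// (le_trans hC')// /D lerDl.
have h_near n x : h x - D / n.+1%:R <= h_ n x <= h x.
  rewrite h_E; have /andP[h0 hC'] := hC x.
  set u := h x * n.+1%:R / D.
  have u0 : 0 <= u by rewrite divr_ge0 ?mulr_ge0// ltW.
  have c0 : 0 < D / n.+1%:R by rewrite divr_gt0.
  have -> : h x = D / n.+1%:R * u.
    by rewrite /u; field; rewrite gt_eqF//= -natrD pnatr_eq0.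
  have /andP[u1 u2] := truncn_itv u0.
  rewrite -[X in _ - X]mulr1 -mulrBr !ler_pM2l// u1 andbT.
  by rewrite lerBlDr ltW//; rewrite -natr1 in u2.
have levE n k : exists rho : nat -> R -> R, [/\ forall j, continuous (rho j),
    forall j x, 0 <= rho j x <= 1 & forall x, rho j x @[j --> \oo] --> ((lev n k x)%:R : R)].
  apply: ray_indicator_limit => a b ab; rewrite /lev => /le_trans; apply.
  by rewrite ler_pM2r ?invr_gt0// ler_pM2r//; exact: hd.
have sh_ n : substitutes (h_ n).
  have {levE}/choice[rho rhoP] := levE n.
  pose g j x := D / n.+1%:R * \sum_(k < n.+1) rho k j x.
  have cg j : continuous (g j).
    move=> x; apply: cvgM; first exact: cvg_cst.
    by apply: cvg_rsum => k _; have [+ _ _] := rhoP k; exact.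
  apply: (@limit_substitutes g _ D).
  - by move=> j; exact: continuous_measurable_fun.
  - move=> j x; have c0 : 0 <= D / n.+1%:R by rewrite divr_ge0// ltW.
    rewrite normrM (ger0_norm c0).
    rewrite -[leRHS]mulr1 -mulrA ler_pM2l// mulrC ler_pdivrMr// mul1r.
    apply: le_trans (ler_norm_sum _ _ _) _.
    apply: (@le_trans _ _ (\sum_(k < n.+1) 1)); last by rewrite sumr_const card_ord.
    apply: ler_sum => k _; have [_ r01 _] := rhoP k.
    by have /andP[r0 r1] := r01 j x; rewrite ger0_norm.
  - move=> x; apply: cvgM; first exact: cvg_cst.
    by apply: cvg_rsum => k _; have [_ _ +] := rhoP k; exact.
  - by move=> j; exact: continuous_substitutes.
apply: (@limit_substitutes h_ h D) => //.
- move=> n; apply: nonincreasing_measurable => // a b ab; rewrite !h_E.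
  have c0 : 0 <= D / n.+1%:R by rewrite divr_ge0// ltW.
  rewrite ler_wpM2l// ler_nat le_truncn//.
  by rewrite ler_pM2r ?invr_gt0// ler_pM2r//; exact: hd.
- move=> n x; have /andP[h1 h2] := h_near n x; have /andP[h0 hC'] := hC x.
  rewrite ger0_norm; last by rewrite h_E mulr_ge0// divr_ge0// ltW.
  by rewrite (le_trans h2)// (le_trans hC')// /D lerDl.
- move=> x; apply: (@squeeze_cvgr _ _ _ _ (fun n => h x - D / n.+1%:R) (fun=> h x)).
  + by apply: nearW => n; exact: h_near.
  + rewrite -[X in _ --> X]subr0; apply: cvgB; first exact: cvg_cst.
    rewrite -[X in _ --> X](mulr0 D); apply: cvgM; first exact: cvg_cst.
    exact: cvg_harmonic.
  + exact: cvg_cst.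
Qed.
End substitution.

(** * Velocities and slopes along the dynamics *)

Lemma Rintegral_sum (R : realType) (I : Type) (r : seq I) (P : pred I)
    (D : set R) (f : I -> R -> R) : measurable D ->
  (forall i, P i -> lebesgue_measure.-integrable D (EFin \o f i)) ->
  lebesgue_measure.-integrable D (EFin \o (fun x => \sum_(i <- r | P i) f i x)) /\
  \int[lebesgue_measure]_(x in D) (\sum_(i <- r | P i) f i x) =
  \sum_(i <- r | P i) \int[lebesgue_measure]_(x in D) f i x.
Proof.
move=> mD fi; elim: r => [|i r [IH1 IH2]].
  split; last by under eq_Rintegral do rewrite big_nil; rewrite Rintegral_cst// mul0r big_nil.
  rewrite (_ : EFin \o _ = cst 0%E); first exact: integrable0.
  by apply/funext => x /=; rewrite big_nil.
have [Pi|Pi] := boolP (P i); last first.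
  split; last by under eq_Rintegral do rewrite big_cons (negbTE Pi); rewrite IH2 big_cons (negbTE Pi).
  rewrite (_ : EFin \o _ = (EFin \o (fun x => \sum_(i <- r | P i) f i x)))//.
  by apply/funext => x /=; rewrite big_cons (negbTE Pi).
split.
  rewrite (_ : EFin \o _ = (EFin \o f i \+ (EFin \o (fun x => (\sum_(i <- r | P i) f i x)%R)))%E).
    by apply: integrableD => //; exact: fi.
  by apply/funext => x /=; rewrite big_cons Pi EFinD.
under eq_Rintegral do rewrite big_cons Pi.
by rewrite RintegralD// ?IH2 ?big_cons ?Pi//; exact: fi.
Qed.

Lemma protocol_integrable (R : realType) (phi : R -> R) :
  protocol phi -> integrable_on_segments phi.
Proof.
move=> hphi a b; have [mphi _ h] := protocol_locint hphi.
apply/integrableP; split.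
  by apply/measurable_EFinP; exact: measurable_funTS.
by apply: h => //; exact: segment_compact.
Qed.

Lemma protocol_primitive_odd (R : realType) (phi : R -> R) : protocol phi ->
  forall x, primitive phi (- x) = - primitive phi x.
Proof.
move=> hphi; have [mphi _ _] := protocol_locint hphi.
by apply: primitive_odd => //; [exact: protocol_ge0 hphi|exact: protocol_even hphi].
Qed.

Lemma protocol_primitive_continuous (R : realType) (phi : R -> R) :
  protocol phi -> continuous (primitive phi).
Proof. by move=> /protocol_integrable; exact: primitive_continuous. Qed.

(** A path that stays away from the origin only sees [phi] cut off near [0],
    which is bounded and nonincreasing. *)
Lemma protocol_substitution_pos (R : realType) (phi y w : R -> R) (s t : R) :
  protocol phi -> s <= t -> continuous y -> continuous w ->
  (forall r, s < r < t -> is_derive r (1 : R) y (w r)) ->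
  (forall r, s <= r <= t -> 0 < y r) ->
  lebesgue_measure.-integrable `[s, t] (EFin \o (fun r => phi (y r) * w r)) /\
  \int[lebesgue_measure]_(r in `[s, t]) (phi (y r) * w r) =
  primitive phi (y t) - primitive phi (y s).
Proof.
move=> hphi st cy cw dy y0.
have [c cst hc] := EVT_min st (continuous_subspaceT cy).
have d0 : 0 < y c by apply: y0; move: cst; rewrite in_itv.
pose h z := phi (Num.max z (y c)).
have max0 z : 0 < Num.max z (y c) by rewrite lt_max d0 orbT.
have hd : {homo h : a b /~ a <= b}.
  move=> a b ab; apply: (protocol_decr hphi); first by rewrite gtr0_norm.
  by rewrite !gtr0_norm ?max0// ge_max !le_max ab lexx orbT.
have hC z : 0 <= h z <= phi (y c).
  rewrite (protocol_ge0 hphi)/=; apply: (protocol_decr hphi).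
    by rewrite gtr0_norm.
  by rewrite !gtr0_norm ?max0// le_max lexx orbT.
have hE z : y c <= z -> h z = phi z by move=> cz; rewrite /h max_l.
have ych r : s <= r <= t -> y c <= y r by move=> rst; apply: hc; rewrite in_itv.
have eqh r : r \in `[s, t]%classic -> phi (y r) * w r = h (y r) * w r.
  by rewrite inE/= in_itv/= => /ych yr; rewrite hE.
have [i1 i2] := nonincreasing_substitution st cy cw dy hd hC.
split.
  apply: eq_integrable i1 => //= r rst; by rewrite eqh.
transitivity (\int[lebesgue_measure]_(r in `[s, t]) (h (y r) * w r)).
  exact: eq_Rintegral.
rewrite i2.
have ih : integrable_on_segments h.
  move=> a b; apply: (@bounded_integrable_segment _ _ (phi (y c))).
    by apply: nonincreasing_measurable => // u z uz; exact: hd.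
  by move=> x _; have /andP[h0 h1] := hC x; rewrite ger0_norm.
have key a b : y c <= a -> a <= b ->
    primitive h b - primitive h a = primitive phi b - primitive phi a.
  move=> ca ab; rewrite !primitiveB//; last exact: protocol_integrable.
  apply: eq_Rintegral => z; rewrite inE/= in_itv/= => /andP[az _].
  by rewrite hE// (le_trans ca).
have ys : y c <= y s by apply: ych; rewrite lexx.
have yt : y c <= y t by apply: ych; rewrite lexx andbT.
have [le1|/ltW le2] := leP (y s) (y t); first exact: key.
by rewrite -opprB key// opprB.
Qed.

Lemma protocol_substitution (R : realType) (phi y w : R -> R) (s t : R) :
  protocol phi -> s <= t -> continuous y -> continuous w ->
  (forall r, s < r < t -> is_derive r (1 : R) y (w r)) ->
  (forall r, s <= r <= t -> 0 < y r) \/ (forall r, s <= r <= t -> y r < 0) ->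
  lebesgue_measure.-integrable `[s, t] (EFin \o (fun r => phi (y r) * w r)) /\
  \int[lebesgue_measure]_(r in `[s, t]) (phi (y r) * w r) =
  primitive phi (y t) - primitive phi (y s).
Proof.
move=> hphi st cy cw dy [y0|y0]; first exact: protocol_substitution_pos.
have [] := @protocol_substitution_pos _ phi (fun r => - y r) (fun r => - w r) s t hphi st.
- by move=> r; apply: cvgN; exact: cy.
- by move=> r; apply: cvgN; exact: cw.
- by move=> r rst; apply: is_deriveN; exact: dy.
- by move=> r rst; rewrite oppr_gt0; exact: y0.
have E r : phi (- y r) * - w r = - (phi (y r) * w r).
  by rewrite (protocol_even hphi) mulrN.
rewrite !protocol_primitive_odd// opprK.
move=> i1 i2.
have i3 : lebesgue_measure.-integrable `[s, t] (EFin \o (fun r => phi (y r) * w r)).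
  have : lebesgue_measure.-integrable `[s, t] (fun r => - (phi (- y r) * - w r)%R%:E)%E.
    exact: (integrableN i1).
  by apply: eq_integrable => //= r rst; rewrite E opprK.
split => //.
apply: oppr_inj; rewrite opprB addrC -i2.
under [RHS]eq_Rintegral do rewrite E -mulN1r.
by rewrite RintegralZl// mulN1r.
Qed.

Section dynamics.
Context (R : realType) (phi : R -> R) (hphi : protocol phi) (N : nat)
  (m x0 v0 : 'I_N -> R) (hm : forall i, 0 < m i)
  (x v : 'I_N -> R -> R) (hxv : sticky_dynamics phi m x0 v0 x v).

(** The speed at which the conservation law transports the mass of particle
    [i], once the nonlocal term is moved to the right-hand side. *)
Definition flux_slope (i : 'I_N) (t : R) : R :=
  v i t + \sum_(j < N) m j * primitive phi (x i t - x j t).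

Local Notation psi := flux_slope.

Lemma sticking (i j : 'I_N) (s t : R) :
  0 <= s <= t -> x i s = x j s -> x i t = x j t.
Proof.
move=> st xs; have /fintype.subsetP/(_ j) := sticky_sticking hxv i st.
by rewrite !inE xs eqxx => /(_ isT)/eqP.
Qed.

Lemma position_clamp_continuous (i : 'I_N) (s t : R) : 0 <= s -> s <= t ->
  continuous (x i \o clamp s t).
Proof.
move=> s0 st; apply: clamp_comp_continuous => //.
have h := @sticky_pos_continuous _ _ _ _ _ _ _ _ hxv i.
apply: (continuous_subspaceW _ h) => r /=.
by rewrite !in_itv/= andbT => /andP[sr _]; exact: le_trans sr.
Qed.

Section free_interval.
Context (s t : R) (s0 : 0 <= s) (st : s <= t)
  (free : forall r, s < r <= t -> ~ collision_time x r)
  (same : forall i j, x i t = x j t -> x i s = x j s).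

Let st0 : 0 <= s <= t. Proof. by rewrite s0 st. Qed.

Let sameP (i j : 'I_N) (r : R) : s <= r <= t -> (x j r == x i r) = (x j s == x i s).
Proof.
move=> /andP[sr rt]; apply/eqP/eqP => h.
  by apply: same; apply: sticking h; rewrite rt (le_trans s0).
by apply: sticking h; rewrite s0 sr.
Qed.

Let force i := alignment_force phi m x v i.

Let vc i r := v i s + parameterized_integral lebesgue_measure s (clamp s t r) (force i).

Let vcE i r : s <= r <= t -> vc i r = v i r.
Proof.
move=> /andP[sr rt]; rewrite /vc clamp_id ?sr ?rt//.
have sr0 : 0 <= s <= r by rewrite s0 sr.
have freer u : s < u <= r -> ~ collision_time x u.
  by move=> /andP[su ur]; apply: free; rewrite su (le_trans ur).
by have [_ ->] := sticky_vel_ode hxv i sr0 freer.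
Qed.

Let vc_continuous i : continuous (vc i).
Proof.
move=> r; apply: cvgD; first exact: cvg_cst.
have [fi _] := sticky_vel_ode hxv i st0 free.
exact: (clamp_comp_continuous st (parameterized_integral_continuous st fi)).
Qed.

Let xc i := x i \o clamp s t.

Let xc_derive i r : s < r < t -> is_derive r (1 : R) (xc i) (vc i r).
Proof.
move=> /andP[sr rt]; rewrite vcE ?(ltW sr) ?(ltW rt)//.
apply: clamp_is_derive; first by rewrite sr.
apply: (sticky_pos_ode hxv); first exact: le_lt_trans sr.
by apply: free; rewrite sr ltW.
Qed.

(** The alignment force is minus the time derivative of the sum of the
    [m j * Phi (x i - x j)]: this is the substitution formula along each
    difference of positions, which keeps its sign between collisions. *)
Lemma flux_slope_free (i : 'I_N) : psi i t = psi i s.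
Proof.
pose y j r := xc j r - xc i r.
pose w j r := vc j r - vc i r.
have yE j r : s <= r <= t -> y j r = x j r - x i r.
  by move=> rst; rewrite /y /xc/= clamp_id.
have cy j : continuous (y j).
  by move=> r; apply: cvgB; exact: position_clamp_continuous.
have cw j : continuous (w j) by move=> r; apply: cvgB; exact: vc_continuous.
have dy j r : s < r < t -> is_derive r (1 : R) (y j) (w j r).
  by move=> rst; apply: is_deriveB; exact: xc_derive.
have sgn j : x j s != x i s ->
    (forall r, s <= r <= t -> 0 < y j r) \/ (forall r, s <= r <= t -> y j r < 0).
  move=> xji; have [ij|ji] := leqP i j; [left|right] => r rst; rewrite yE//.
    rewrite subr_gt0 lt_neqAle eq_sym sameP// xji/=.
    by apply: (sticky_ordered hxv) => //; have /andP[+ _] := rst; exact: le_trans.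
  rewrite subr_lt0 lt_neqAle sameP// xji/=.
  by apply: (sticky_ordered hxv); [exact: ltnW|have /andP[+ _] := rst; exact: le_trans].
have sub j : x j s != x i s ->
    lebesgue_measure.-integrable `[s, t] (EFin \o (fun r => m j * (phi (y j r) * w j r))) /\
    \int[lebesgue_measure]_(r in `[s, t]) (m j * (phi (y j r) * w j r)) =
    m j * (primitive phi (y j t) - primitive phi (y j s)).
  move=> xji; have [i1 i2] := protocol_substitution hphi st (cy j) (cw j) (dy j) (sgn j xji).
  split; last by rewrite RintegralZl// i2.
  by apply: eq_integrable (integrableZl _ (m j) i1) => // r _; rewrite /= EFinM.
rewrite /flux_slope; have [_ ->] := sticky_vel_ode hxv i st0 free.
have -> : \int[lebesgue_measure]_(r in `[s, t]) alignment_force phi m x v i r =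
    \int[lebesgue_measure]_(r in `[s, t])
      (\sum_(j < N | x j s != x i s) m j * (phi (y j r) * w j r)).
  apply: eq_Rintegral => r; rewrite inE/= in_itv/= => rst.
  rewrite /alignment_force; apply: eq_big => j; first by rewrite sameP.
  by move=> _; rewrite yE// /w !vcE// mulrA.
rewrite (Rintegral_sum _ _ (fun j xji => (sub j xji).1)).2//.
under eq_bigr => j xji do rewrite (sub j xji).2.
rewrite -addrA; congr (_ + _).
rewrite big_mkcond/= -big_split/=; apply: eq_bigr => j _.
have yt : y j t = - (x i t - x j t) by rewrite yE ?st ?lexx// opprB.
have ys : y j s = - (x i s - x j s) by rewrite yE ?st ?lexx// opprB.
case: ifPn => [_|]; last first.
  rewrite negbK => /eqP xs; rewrite add0r xs subrr (sticking st0 xs) subrr.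
  by [].
rewrite yt ys !(protocol_primitive_odd hphi); ring.
Qed.

End free_interval.

Section collision.
Context (s tau : R) (s0 : 0 <= s) (st : s < tau)
  (coll : collision_time x tau)
  (free : forall r, s < r < tau -> ~ collision_time x r)
  (same : forall i j r, s <= r < tau -> x i r = x j r -> x i s = x j s).

Let drift i t := \sum_(j < N) m j * primitive phi (x i t - x j t).

Let velE i r : s <= r < tau -> v i r = psi i s - drift i r.
Proof.
move=> /andP[sr rt]; rewrite -(@flux_slope_free s r s0 sr).
- by rewrite /flux_slope /drift addrK.
- by move=> u /andP[su ur]; apply: free; rewrite su (le_lt_trans ur).
- by move=> k l; apply: same; rewrite sr.
Qed.

Let position_left i : x i r @[r --> tau^'-] --> x i tau.
Proof.
have tau1 : tau < tau + 1 by rewrite ltrDl.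
have := @position_clamp_continuous i s (tau + 1) s0 _ tau.
rewrite (le_trans (ltW st) (ltW tau1)) => /(_ isT).
rewrite /comp /continuous_at clamp_id ?(ltW st) ?(ltW tau1)// => h.
have {}h : (x i \o clamp s (tau + 1)) r @[r --> tau^'-] --> x i tau.
  exact: cvg_at_left_filter h.
apply: cvg_trans h; apply: near_eq_cvg; near=> r; rewrite /= clamp_id//.
apply/andP; split; first by near: r; exact: nbhs_left_ge.
by apply: (le_trans _ (ltW tau1)); near: r; exact: nbhs_left_le.
Unshelve. all: by end_near. Qed.

Let drift_left i : drift i r @[r --> tau^'-] --> drift i tau.
Proof.
apply: cvg_rsum => j _; apply: cvgM; first exact: cvg_cst.
apply: (@cvg_comp _ _ _ (fun r => x i r - x j r) (primitive phi)); last first.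
  exact: protocol_primitive_continuous.
by apply: cvgB; exact: position_left.
Qed.

Let vel_left i : v i r @[r --> tau^'-] --> psi i s - drift i tau.
Proof.
have h : psi i s - drift i r @[r --> tau^'-] --> psi i s - drift i tau.
  by apply: cvgB; [exact: cvg_cst|exact: drift_left].
apply: cvg_trans h; apply: near_eq_cvg; near=> r; rewrite velE//.
by apply/andP; split; near: r; [exact: nbhs_left_ge|exact: nbhs_left_lt].
Unshelve. all: by end_near. Qed.

(** The positions, hence the nonlocal part of the slopes, are continuous through
    the collision and equal inside a group, so the conservation of momentum is
    inherited by the slopes. *)
Lemma flux_slope_collision (i : 'I_N) :
  psi i tau = group_average m x (psi ^~ s) i tau.
Proof.
have [w [wlim vE]] := sticky_collision hxv coll.
have wE j : w j = psi j s - drift j tau.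
  exact: (cvg_unique _ (wlim j) (@vel_left j)).
rewrite [LHS]/flux_slope vE /group_average.
have W0 : \sum_(j in sticky_group x i tau) m j != 0.
  by rewrite gt_eqF// sticky_group_mass_gt0.
apply: (mulIf W0); rewrite mulrDl !divfK// mulr_sumr -big_split/=.
apply: eq_bigr => j; rewrite inE => /eqP xji.
by rewrite wE /drift xji; ring.
Qed.

(** If the slopes increased inside a colliding group, the velocities would do so
    just before the collision, and the two particles would be moving apart while
    they are about to meet. *)
Lemma flux_slope_incoming (i j : 'I_N) : (i <= j)%N -> x i tau = x j tau ->
  psi j s <= psi i s.
Proof.
move=> ij xij; rewrite leNgt; apply/negP => psiij.
have drift_eq : drift i tau = drift j tau by rewrite /drift xij.
have L : v j r - v i r @[r --> tau^'-] --> psi j s - psi i s.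
  rewrite (_ : psi j s - psi i s = (psi j s - drift j tau) - (psi i s - drift i tau)).
    by apply: cvgB; exact: vel_left.
  by rewrite drift_eq; ring.
have pos : \forall r \near tau^'-, 0 < v j r - v i r.
  by apply: (cvgr_gt _ L); rewrite subr_gt0.
move: pos => [e /= e0 he].
pose a := Num.max s (tau - e).
have sa : s <= a by rewrite /a le_max lexx.
have at_ : a < tau by rewrite /a gt_max st ltrBlDr ltrDl.
pose y r := (x j \o clamp s tau) r - (x i \o clamp s tau) r.
have dy r : r \in `]a, tau[%R -> is_derive r (1 : R) y (v j r - v i r).
  rewrite in_itv/= => /andP[ar rt].
  have sr : s < r by exact: le_lt_trans ar.
  apply: is_deriveB; apply: clamp_is_derive; rewrite ?sr ?rt//;
    (apply: (sticky_pos_ode hxv); [exact: le_lt_trans sr|by apply: free; rewrite sr]).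
have cy : {within `[a, tau], continuous y}.
  by apply: continuous_subspaceT => r; apply: cvgB; apply: position_clamp_continuous => //; exact: ltW.
have [r rat] := MVT at_ dy cy.
rewrite /y /= !clamp_id ?lexx ?(ltW st) ?sa ?(ltW at_)// xij subrr sub0r => Er.
have : 0 < (v j r - v i r) * (tau - a).
  apply: mulr_gt0; last by rewrite subr_gt0.
  move: rat; rewrite in_itv/= => /andP[ar rt]; apply: he => //=.
  rewrite gtr0_norm ?subr_gt0// ltrBlDr -ltrBlDl.
  by apply: le_lt_trans ar; rewrite /a le_max lexx orbT.
rewrite -Er ltNge oppr_le0 subr_ge0 => /negP; apply.
by apply: (sticky_ordered hxv) => //; exact: le_trans sa.
Qed.

End collision.
End dynamics.

(** * The chord condition *)

Section slope_invariant.
Context (R : realType) (phi : R -> R) (hphi : protocol phi) (N : nat)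
  (m x0 v0 psi0 : 'I_N -> R) (hm : forall i, 0 < m i)
  (hv0 : forall i,
     v0 i = psi0 i - \sum_(j < N) m j * primitive phi (x0 i - x0 j))
  (x v : 'I_N -> R -> R) (hxv : sticky_dynamics phi m x0 v0 x v).

Local Notation psi := (flux_slope phi m x v).

(** The height, at [theta m k], of the graph of [A] above the polygon that starts
    from it at [- 2^-1] and has the slopes carried at time [t]. That it is
    nonnegative is the Oleinik chord condition on each jump of the profile; that
    it vanishes at saturated [k] says that the polygon meets [A] at the values of
    the profile. *)
Definition slope_defect (k : nat) (t : R) :=
  \sum_(j < N | (j < k)%N) m j * (psi0 j - psi j t).

Record slope_invariant (t : R) : Prop := SlopeInvariant {
  invariant_ge0 : forall k, 0 <= slope_defect k t;
  invariant_eq0 : forall k, saturated (x ^~ t) k -> slope_defect k t = 0;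
  invariant_bound : forall B, (forall j, `|psi0 j| <= B) ->
    forall i, `|psi i t| <= B }.

Let invariant_average (u : 'I_N -> R) (t : R)
    (hpsi : forall i, psi i t = group_average m x u i t)
    (hu : forall i j : 'I_N, (i <= j)%N -> x i t = x j t -> u j <= u i)
    (ge0 : forall k, 0 <= \sum_(j < N | (j < k)%N) m j * (psi0 j - u j))
    (eq0 : forall k, saturated (x ^~ t) k ->
      \sum_(j < N | (j < k)%N) m j * (psi0 j - u j) = 0)
    (bnd : forall B, (forall j, `|psi0 j| <= B) -> forall i, `|u i| <= B) :
  slope_invariant t.
Proof.
have defectE k : slope_defect k t =
    \sum_(j < N | (j < k)%N) m j * (psi0 j - u j) +
    \sum_(j < N | (j < k)%N) m j * (u j - group_average m x u j t).
  by rewrite -big_split/=; apply: eq_bigr => j _; rewrite hpsi; ring.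
split.
- by move=> k; rewrite defectE addr_ge0// prefix_average_ge0.
- by move=> k hk; rewrite defectE eq0// prefix_average_eq0// addr0.
- move=> B hB i; rewrite hpsi /group_average normrM normfV.
  have W0 := sticky_group_mass_gt0 x t hm i.
  rewrite (gtr0_norm W0) ler_pdivrMr// mulr_sumr.
  apply: le_trans (ler_norm_sum _ _ _) _; apply: ler_sum => j _.
  by rewrite normrM gtr0_norm// mulrC ler_wpM2r ?(ltW (hm _))// bnd.
Qed.

Let invariant_transfer (s t : R) : 0 <= s <= t ->
  (forall i, psi i t = psi i s) -> slope_invariant s -> slope_invariant t.
Proof.
move=> st psiE [i2 i3 i4].
have dE k : slope_defect k t = slope_defect k s.
  by apply: eq_bigr => j _; rewrite psiE.
split=> [k|k hk|B /i4 hB i]; rewrite ?psiE ?dE//.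
apply: i3 => i j ij; apply: contra (hk i j ij) => /eqP xs; apply/eqP.
exact: (sticking hxv st).
Qed.

Let invariant_init : slope_invariant 0.
Proof.
have hv0' i : v0 i = psi0 i - \sum_(j < N) m j * primitive phi (x i 0 - x j 0).
  by rewrite hv0; congr (_ - _); apply: eq_bigr => l _; rewrite !(sticky_init_pos hxv).
apply: (@invariant_average psi0).
- move=> i; rewrite /flux_slope (sticky_init_vel hxv) /group_average.
  have W0 : \sum_(j in sticky_group x i 0) m j != 0.
    by rewrite gt_eqF// sticky_group_mass_gt0.
  apply: (mulIf W0); rewrite mulrDl !divfK// mulr_sumr -big_split/=.
  apply: eq_bigr => j; rewrite inE => /eqP xji.
  by rewrite hv0' xji; ring.
- move=> i j ij xij; have xij0 : x0 i = x0 j by rewrite -!(sticky_init_pos hxv).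
  by have := sticky_init_incoming hxv ij xij0; rewrite !hv0' xij lerD2r.
- by move=> k; rewrite big1// => j _; rewrite subrr mulr0.
- by move=> k _; rewrite big1// => j _; rewrite subrr mulr0.
- by [].
Qed.

(** Nondecreasing in time and strictly increased by each collision: it bounds
    the number of collision times and supports an induction over them. *)
Definition contacts (t : R) : nat := (\sum_(i < N) #|sticky_group x i t|)%N.

Let contactsP (s t : R) : 0 <= s <= t ->
  (contacts s <= contacts t ?= iff
    [forall i, sticky_group x i s == sticky_group x i t])%N.
Proof.
move=> st; apply: leqif_sum => i _.
exact: subset_leqif_cards (sticky_sticking hxv i st).
Qed.

Let contacts_eq (s t : R) : 0 <= s <= t -> contacts s = contacts t ->
  forall i, sticky_group x i s = sticky_group x i t.
Proof.
move=> st E i; have [_] := contactsP st; rewrite E eqxx => /esym/forallP/(_ i).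
by move/eqP.
Qed.

Let contacts_same (s t : R) : 0 <= s <= t -> contacts s = contacts t ->
  forall i j, x i t = x j t -> x i s = x j s.
Proof.
move=> st E i j xij; have /setP/(_ j) := contacts_eq st E i.
by rewrite !inE xij eqxx => /eqP.
Qed.

Lemma contacts_collision (s t : R) : 0 <= s < t -> collision_time x t ->
  (contacts s < contacts t)%N.
Proof.
move=> /andP[s0 st] [_ [i hi]].
have sti : 0 <= s <= t by rewrite s0 ltW.
rewrite (ltn_leqif (contactsP sti)); apply/forallPn; exists i.
by apply: contraTneq (hi s _) => [->|]; rewrite ?ltnn// s0.
Qed.

(** Distinct collision times have distinct numbers of contacts. *)
Lemma finite_collision_times : finite_set [set t | collision_time x t].
Proof.
pose pick n := xget 0 [set t | collision_time x t /\ contacts t = n].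
apply: (@sub_finite_set _ _ (pick @` `I_(N * N).+1)).
  move=> t ct; exists (contacts t).
    rewrite /= ltnS; apply: leq_trans (_ : (\sum_(i < N) N <= _)%N).
      by apply: leq_sum => i _; rewrite -[leqRHS]card_ord max_card.
    by rewrite sum_nat_const card_ord.
  have : exists u, [set u | collision_time x u /\ contacts u = contacts t] u by exists t.
  move=> /(xgetPex 0)/=; rewrite -/(pick (contacts t)); set u := pick _ => -[cu ctu].
  have [tu|ut|//] := ltgtP u t.
    have := @contacts_collision u t _ ct; rewrite ctu ltnn => h.
    by have /h : 0 <= u < t; rewrite // tu andbT ltW//; case: cu.
  have := @contacts_collision t u _ cu; rewrite ctu ltnn => h.
  by have /h : 0 <= t < u; rewrite // ut andbT ltW//; case: ct.
exact/finite_image/finite_II.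
Qed.

(** Positions are continuous, so contacts that hold right after [tau] hold at
    [tau]. *)
Let contacts_sup_closed (tau t : R) : 0 <= tau <= t ->
  (forall r, tau < r <= t -> contacts r = contacts t) ->
  contacts tau = contacts t.
Proof.
move=> /andP[tau0]; rewrite le_eqVlt => /predU1P[-> //|taut] h.
apply/eqP; rewrite eqn_leq (contactsP _).1 ?tau0 ?ltW//=.
apply: leq_sum => i _; apply/subset_leq_card/fintype.subsetP => j.
rewrite !inE => /eqP xji; apply/eqP.
pose f r := (x j \o clamp tau t) r - (x i \o clamp tau t) r.
have cf : continuous f.
  by move=> r; apply: cvgB; apply: (position_clamp_continuous hxv) => //; exact: ltW.
have f0 : f r @[r --> tau^'+] --> (0 : R).
  apply: cvg_near_cst; near=> r.
  have rt : tau < r <= t.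
    by apply/andP; split; near: r; [exact: nbhs_right_gt|exact: nbhs_right_le].
  have /andP[taur rt'] := rt.
  rewrite /f /= clamp_id ?(ltW taur)// (@contacts_same r t _ _ j i)// ?subrr//.
    by rewrite rt' (le_trans tau0)// ltW.
  exact: h.
have ft : f r @[r --> tau^'+] --> f tau by apply: cvg_at_right_filter; exact: cf.
have : f tau = 0 by exact: (cvg_unique _ ft f0).
by rewrite /f /= clamp_id ?lexx ?ltW// => /eqP; rewrite subr_eq0 => /eqP.
Unshelve. all: by end_near. Qed.

(** By induction on the number of contacts. Let [tau] be the first time at which
    this number has its value at [t]: the slopes are constant from [tau] to [t].
    Unless [tau = 0], it is a collision time, the slopes are constant just before
    it, and at [tau] they are averaged over the new groups. Averaging preserves
    the invariant because the incoming slopes are nonincreasing in each group. *)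
Lemma slope_invariant_holds (t : R) : 0 <= t -> slope_invariant t.
Proof.
have [n] := ubnP (contacts t); elim: n t => // n IH t /ltnSE tn t0.
have [empty|/existsNP[r0 /not_implyP[r0t /negP nr0]]] :=
    pselect (forall r, 0 <= r <= t -> ~~ (contacts r < contacts t)%N).
  have cE r : 0 <= r <= t -> contacts r = contacts t.
    move=> rt; apply/eqP; rewrite eqn_leq (contactsP rt).1/= leqNgt.
    exact: empty.
  have t00 : 0 <= (0 : R) <= t by rewrite lexx.
  apply: (invariant_transfer t00 _ invariant_init).
  move=> i; apply: (flux_slope_free hphi hxv _ t0) => //.
    move=> r /andP[r0 rt] cr; have := @contacts_collision 0 r _ cr.
    by rewrite r0 lexx (cE 0 t00) (cE r) ?rt ?ltW// ltnn => /(_ isT).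
  by apply: contacts_same => //; exact: cE.
pose E := [set r | 0 <= r <= t /\ (contacts r < contacts t)%N].
have Er0 : E r0 by split => //; exact: negbNE.
have ubE : has_ubound E by exists t => r [/andP[]].
pose tau := sup E.
have r0tau : r0 <= tau by exact: (ub_le_sup ubE Er0).
have r00 : 0 <= r0 by case/andP: r0t.
have tau0 : 0 <= tau by exact: le_trans r0tau.
have taut : tau <= t by apply: ge_sup => [|r [/andP[]]]; first by exists r0.
have tau0t : 0 <= tau <= t by rewrite tau0.
have after r : tau < r <= t -> contacts r = contacts t.
  move=> /andP[taur rt]; have rt' : 0 <= r <= t by rewrite rt (le_trans tau0)// ltW.
  apply/eqP; rewrite eqn_leq (contactsP rt').1/= leqNgt; apply/negP => cr.
  by move: taur; rewrite ltNge => /negP; apply; exact: ub_le_sup.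
have before r : 0 <= r < tau -> (contacts r < contacts t)%N.
  move=> /andP[r0' /(sup_gt (ex_intro _ r0 Er0))[u [ut cu] ru]].
  have rut : 0 <= r <= u by rewrite r0' ltW.
  exact: leq_ltn_trans (contactsP rut).1 cu.
have ctau : contacts tau = contacts t by exact: contacts_sup_closed.
have taupos : 0 < tau.
  rewrite (le_lt_trans r00)// lt_neqAle r0tau andbT.
  apply/negP => /eqP r0E; have := Er0.2; rewrite r0E. by rewrite ctau ltnn.
apply: (invariant_transfer tau0t).
  move=> i; apply: (flux_slope_free hphi hxv) => //; last exact: contacts_same.
  move=> r rt cr; have := @contacts_collision tau r _ cr.
  have /andP[taur _] := rt.
  by rewrite tau0 taur (after r rt) ctau ltnn => /(_ isT).
(* Just before [tau] the number of contacts is constant. *)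
have [s /andP[s0 stau] smax] : exists2 s, 0 <= s < tau &
    forall r, 0 <= r < tau -> (contacts r <= contacts s)%N.
  pose P k := `[< exists2 r, 0 <= r < tau & contacts r = k >].
  have exP : exists k, P k.
    by exists (contacts 0); apply/asboolP; exists 0; rewrite // lexx.
  have ubP k : P k -> (k <= contacts t)%N.
    by move=> /asboolP[r /before cr <-]; exact: ltnW.
  case: (ex_maxnP exP ubP) => k /asboolP[s sI <-] kmax.
  by exists s => // r rI; apply: kmax; apply/asboolP; exists r.
have sE r : s <= r < tau -> contacts s = contacts r.
  move=> /andP[sr rtau]; have sr' : 0 <= s <= r by rewrite s0.
  apply/eqP; rewrite eqn_leq (contactsP sr').1 smax//.
  by rewrite rtau (le_trans s0).
have cs : (contacts s < contacts t)%N by apply: before; rewrite s0.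
have Is : slope_invariant s by apply: IH => //; exact: leq_trans cs tn.
have stau' : 0 <= s <= tau by rewrite s0 ltW.
have coll : collision_time x tau.
  split=> //; have [i hi] : exists i, (#|sticky_group x i s| < #|sticky_group x i tau|)%N.
    apply/existsP; rewrite -[X in is_true X]negbK; apply/negP => /existsPn h.
    move: cs; rewrite ltnNge -ctau => /negP; apply.
    by apply: leq_sum => i _; rewrite leqNgt.
  exists i => r /andP[r0' rtau]; apply: leq_ltn_trans hi.
  have [rs|/ltW sr] := leP r s.
    by apply/subset_leq_card/(sticky_sticking hxv); rewrite r0'.
  rewrite (@contacts_eq s r) ?s0 ?sr//.
  by apply: sE; rewrite sr.
have free r : s < r < tau -> ~ collision_time x r.
  move=> /andP[sr rtau] cr; have := @contacts_collision s r _ cr.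
  by rewrite s0 sr -sE ?(ltW sr)// ltnn => /(_ isT).
have same i j r : s <= r < tau -> x i r = x j r -> x i s = x j s.
  move=> /andP[sr rtau]; apply: contacts_same; first by rewrite s0.
  by apply: sE; rewrite sr.
have [i2 i3 i4] := Is.
apply: (@invariant_average (psi ^~ s)) => //.
- by move=> i; apply: (flux_slope_collision hphi hm hxv s0 stau coll).
- by move=> i j; apply: (flux_slope_incoming hphi hxv s0 stau).
- move=> k hk; apply: i3 => i j ij; apply: contra (hk i j ij) => /eqP xs; apply/eqP.
  exact: (sticking hxv stau').
Qed.

End slope_invariant.

(** * Entropy pairs and convolutions of step profiles *)

Lemma theta_le (R : realType) (N : nat) (m : 'I_N -> R) (j k : nat) :
  (forall i, 0 < m i) -> (j <= k)%N -> theta m j <= theta m k.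
Proof.
move=> hm jk; rewrite /theta lerD2l [leLHS]big_mkcond [leRHS]big_mkcond/=.
apply: ler_sum => i _; case: ifPn => ij; first by rewrite (leq_trans ij).
by case: ifPn => // _; exact: ltW.
Qed.

Lemma theta_full (R : realType) (N : nat) (m : 'I_N -> R) :
  \sum_(j < N) m j = 1 -> theta m N = 2^-1.
Proof.
move=> hm1; rewrite /theta (eq_bigl xpredT) ?hm1; last by move=> j; rewrite ltn_ord.
lra.
Qed.

Lemma theta_bounds (R : realType) (N : nat) (m : 'I_N -> R) (k : nat) :
  (forall i, 0 < m i) -> \sum_(j < N) m j = 1 -> (k <= N)%N ->
  - 2^-1 <= theta m k <= 2^-1.
Proof.
move=> hm hm1 kN; rewrite -{1}(theta0 m) -(theta_full hm1).
by rewrite !theta_le.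
Qed.

Lemma lipschitz_constant (R : realType) (f : R -> R) (A : set R) :
  [lipschitz f u | u in A] ->
  exists2 L, 0 < L & forall u v, A u -> A v -> `|f u - f v| <= L * `|u - v|.
Proof.
move=> fL.
have : \forall L \near +oo, 0 < L /\ L.-lipschitz_A f.
  near=> L; split; first by near: L; exact: nbhs_pinfty_gt.
  by near: L; exact: fL.
move=> /filter_ex[L [L0 hL]].
exists L => // u v Au Av; exact: (hL (u, v)).
Unshelve. all: by end_near. Qed.

Lemma convex_slope_le (R : realType) (eta : R -> R) (a b c : R) :
  convex_function (`[- 2^-1, 2^-1] : set R) eta ->
  - 2^-1 <= a -> a < b -> b < c -> c <= 2^-1 ->
  (eta b - eta a) / (b - a) <= (eta c - eta b) / (c - b).
Proof.
move=> hc ah ab bc ch.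
have ba0 : 0 < b - a by rewrite subr_gt0.
have cb0 : 0 < c - b by rewrite subr_gt0.
have ca0 : 0 < c - a by rewrite subr_gt0 (lt_trans ab).
have l0 : 0 <= (c - b) / (c - a) by rewrite divr_ge0// ltW.
have l1 : (c - b) / (c - a) <= 1 by rewrite ler_pdivrMr// mul1r; lra.
have aA : a \in (`[- 2^-1, 2^-1]%classic : set R) by rewrite inE/= in_itv/=; lra.
have cA : c \in (`[- 2^-1, 2^-1]%classic : set R) by rewrite inE/= in_itv/=; lra.
pose l := (c - b) / (c - a).
have h : eta (l * a + (1 - l) * c) <= l * eta a + (1 - l) * eta c := hc (Itv01 l0 l1) a c aA cA.
have lE : l * a + (1 - l) * c = b by rewrite /l; field; rewrite gt_eqF.
rewrite lE in h.
have h2 : (c - a) * eta b <= (c - b) * eta a + (b - a) * eta c.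
  have -> : (c - b) * eta a + (b - a) * eta c = (c - a) * (l * eta a + (1 - l) * eta c).
    by rewrite /l; field; rewrite gt_eqF.
  by rewrite ler_pM2l.
rewrite ler_pdivrMr// mulrAC ler_pdivlMr//; lra.
Qed.

(** On a piece of [A] of slope [p], the derivative of [q - p * eta] vanishes
    almost everywhere, and this function is Lipschitz. *)
Lemma entropy_flux_increment (R : realType) (A eta q : R -> R) (a b p : R) :
  entropy_pair A eta q -> - 2^-1 <= a -> a < b -> b <= 2^-1 ->
  (forall z, a < z < b -> derive1 A z = p) ->
  q b - q a = p * (eta b - eta a).
Proof.
move=> [_ etaL qL ae] ah ab bh dA.
have [Le Le0 hLe] := lipschitz_constant etaL.
have [Lq Lq0 hLq] := lipschitz_constant qL.
pose f z := (fun z => q z - p * eta z) (clamp a b z).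
have inI z : a <= z <= b -> (`[- 2^-1, 2^-1]%classic : set R) z.
  by move=> /andP[az zb]; rewrite /= in_itv/= (le_trans ah az) (le_trans zb bh).
have fL y z : `|f y - f z| <= (Lq + `|p| * Le) * `|y - z|.
  rewrite /f /=.
  have -> : q (clamp a b y) - p * eta (clamp a b y) - (q (clamp a b z) - p * eta (clamp a b z)) =
     (q (clamp a b y) - q (clamp a b z)) - p * (eta (clamp a b y) - eta (clamp a b z)) by ring.
  apply: le_trans (ler_normB _ _) _; rewrite mulrDl normrM -mulrA.
  have cI u : (`[- 2^-1, 2^-1]%classic : set R) (clamp a b u).
    by apply/inI/clamp_itv; exact: ltW.
  apply: lerD.
    by apply: le_trans (hLq _ _ (cI _) (cI _)) _; rewrite ler_pM2l// clamp_lipschitz.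
  rewrite ler_wpM2l//; apply: le_trans (hLe _ _ (cI _) (cI _)) _.
  by rewrite ler_pM2l// clamp_lipschitz.
have df : {ae lebesgue_measure, forall z : R, a < z < b -> is_derive z (1 : R) f 0}.
  move: ae; apply: filterS; first exact: (ae_filter_ringOfSetsType lebesgue_measure).
  move=> z h zab; have zI : - 2^-1 < z < 2^-1.
    by have /andP[az zb] := zab; rewrite (le_lt_trans ah az) (lt_le_trans zb bh).
  have [de _ dq] := h zI.
  have dee : is_derive z (1 : R) eta (derive1 eta z) by exact: is_derive_derive1.
  have dqe := is_deriveB dq (is_deriveZ p dee).
  have d0 : derive1 eta z * derive1 A z - p *: derive1 eta z = 0.
    by rewrite (dA z zab) /GRing.scale/= mulrC subrr.
  rewrite d0 in dqe.
  exact: (clamp_is_derive zab dqe).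
have [|_] := @lipschitz_FTC R f (fun=> 0) a b _ ab fL _ df; first exact: measurable_cst.
rewrite Rintegral_cst// mul0r /f /= !clamp_id ?lexx ?ltW// => /esym; lra.
Qed.

(** The window cuts the constant [- 2^-1] down to [- Phi (2 * r)], which cancels
    the lower bounds of the integrals that come from the jumps, since the masses
    sum to [1] and [Phi] is odd. *)
Lemma convolution_step_profile (R : realType) (phi : R -> R) (N : nat)
    (m y : 'I_N -> R) (R0 x : R) : protocol phi -> \sum_(j < N) m j = 1 ->
  0 < R0 -> (forall j, `|y j| <= R0) ->
  convolution phi R0 (step_profile m y) x =
  \sum_(j < N) m j * primitive phi (x - y j).
Proof.
move=> hphi hm1 R00 yR.
have iphi := protocol_integrable hphi.
rewrite /convolution; set r := Num.max R0 `|x|.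
have r0 : 0 < r by rewrite /r lt_max R00.
have xr : `|x| <= r by rewrite /r le_max lexx orbT.
have Rr : R0 <= r by rewrite /r le_max lexx.
pose L := 2 * r; rewrite -/L.
have LL : - L <= L by rewrite /L; lra.
have aL j : - L <= x - y j <= L.
  rewrite -ler_norml (le_trans (ler_normB _ _))// /L.
  by have := yR j; move: xr Rr; lra.
pose f j z := (phi \_ `]-oo, x - y j]) z.
have fE j z : phi z * heaviside (x - z - y j) = f j z.
  rewrite /f patchE /heaviside; have -> : (0 <= x - z - y j) = (z <= x - y j).
    by apply/idP/idP; lra.
  have -> : (z \in (`]-oo, (x - y j)]%classic : set R)) = (z <= x - y j).
    by apply/idP/idP; rewrite inE/= in_itv/=.
  by case: ifP; rewrite ?mulr1 ?mulr0.
have setE j : `[- L, L]%classic `&` `]-oo, x - y j] = `[- L, x - y j]%classic :> set R.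
  have /andP[a1 a2] := aL j.
  apply/seteqP; split => z /=; rewrite !in_itv/=.
    by move=> [/andP[-> _]].
  by move=> /andP[z1 z2]; rewrite z1 z2 (le_trans z2).
have fint j : lebesgue_measure.-integrable `[- L, L] (EFin \o f j).
  rewrite /f -restrict_EFin; apply/integrable_restrict => //=.
  by rewrite setE.
have fI j : \int[lebesgue_measure]_(z in `[- L, L]) f j z =
    primitive phi (x - y j) - primitive phi (- L).
  have /andP[a1 a2] := aL j.
  by rewrite /f -Rintegral_mkcondr setE -primitiveB.
have mfint j : lebesgue_measure.-integrable `[- L, L] (EFin \o (fun z => m j * f j z)).
  by apply: eq_integrable (integrableZl _ (m j) (fint j)) => // z _; rewrite /= EFinM.
have [si sI] := @Rintegral_sum R 'I_N (index_enum 'I_N) xpredT `[- L, L]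
  (fun j z => m j * f j z) (measurable_itv _) (fun j _ => mfint j).
have hi : lebesgue_measure.-integrable `[- L, L] (EFin \o (fun z => - 2^-1 * phi z)).
  by apply: eq_integrable (integrableZl _ (- 2^-1) (iphi (- L) L)) => // z _; rewrite /= EFinM.
transitivity (\int[lebesgue_measure]_(z in `[- L, L])
    (- 2^-1 * phi z + \sum_(j < N) m j * f j z)).
  apply: eq_Rintegral => z _; rewrite /step_profile mulrDr mulrC; congr (_ + _).
  by rewrite mulr_sumr; apply: eq_bigr => j _; rewrite -fE mulrCA.
rewrite RintegralD// sI RintegralZl// -primitiveB//.
under eq_bigr => j _ do rewrite RintegralZl// fI protocol_primitive_odd// opprK mulrDr.
rewrite big_split/= -mulr_suml hm1 protocol_primitive_odd//; lra.
Qed.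

(** * Point masses and step functions *)

Section atoms.
Context (R : realType) (N : nat) (w y : 'I_N -> R).

Let weight_ge0 (n : nat) : 0 <= Num.max 0 (if insub n is Some i then w i else 0).
Proof. by rewrite le_max lexx. Qed.

Let weight (n : nat) : {nonneg R} := NngNum (weight_ge0 n).

Let place (n : nat) : measurableTypeR R := if insub n is Some i then y i else 0.

(** Negative weights count as [0], so that [atoms w y] and
    [atoms (- w) y] are the two parts of a signed sum of point masses. *)
Definition atoms : {measure set (measurableTypeR R) -> \bar R} :=
  msum (fun n => mscale (weight n) \d_(place n)) N.

Let atoms_ge0_integral (g : measurableTypeR R -> \bar R) :
  measurable_fun setT g -> (forall x, 0 <= g x)%E ->
  (\int[atoms]_x g x = \sum_(i < N) (Num.max 0 (w i))%:E * g (y i))%E.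
Proof.
move=> mg g0; rewrite /atoms ge0_integral_measure_sum//.
apply: eq_bigr => i _; rewrite ge0_integral_mscale// integral_dirac// diracT mul1e.
by rewrite /weight /place/= valK.
Qed.

Lemma atoms_Rintegral (g : R -> R) :
  measurable_fun setT (g : measurableTypeR R -> measurableTypeR R) ->
  \int[atoms]_x g x = \sum_(i < N) Num.max 0 (w i) * g (y i).
Proof.
move=> mg; rewrite /Rintegral integralE.
have mg' : measurable_fun setT (fun x => (g x)%:E) by apply/measurable_EFinP.
rewrite !atoms_ge0_integral//; [|exact: measurable_funeneg|exact: measurable_funepos].
under eq_bigr do rewrite funeposE -EFin_max -EFinM.
under [X in (_ - X)%E]eq_bigr do rewrite funenegE -EFinN -EFin_max -EFinM.
rewrite !sumEFin -EFinB /= -sumrB; apply: eq_bigr => i _.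
rewrite -mulrBr; congr (_ * _).
by case: (leP (g (y i)) 0) => ?; case: (leP (- g (y i)) 0) => ?; lra.
Qed.

Lemma atoms_fin (K : set (measurableTypeR R)) : (atoms K < +oo)%E.
Proof.
rewrite /atoms /msum; apply: lte_sum_pinfty => i _.
apply: lte_mul_pinfty; rewrite ?lee_fin//.
rewrite -[X in (X < _)%E]/(@dirac _ _ (place i) R K). by rewrite diracE ltry.
Qed.

End atoms.

Lemma Rintegral_support (R : realType) (g : R -> R) (L : R) :
  continuous g -> (forall x, L < `|x| -> g x = 0) ->
  lebesgue_measure.-integrable setT (EFin \o g) /\
  \int[lebesgue_measure]_x g x = \int[lebesgue_measure]_(x in `[- L, L]) g x.
Proof.
move=> cg g0.
have E : g \_ `[- L, L] = g.
  apply/funext => x; rewrite patchE; case: ifPn => //.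
  rewrite notin_setE/= in_itv/= -ler_norml => /negP; rewrite -ltNge => Lx.
  by rewrite g0.
split; last by rewrite [RHS]Rintegral_mkcond E.
rewrite -E -restrict_EFin; apply/integrable_restrict => //=.
by rewrite setTI; exact: continuous_integrable_on_segments.
Qed.

Lemma Rintegral_step_function (R : realType) (N : nat) (c0 L : R)
    (c y : 'I_N -> R) (g : R -> R) (u : R -> R) :
  (forall x, u x = c0 + \sum_(i < N) c i * heaviside (x - y i)) ->
  continuous g -> (forall x, L < `|x| -> g x = 0) -> (forall i, `|y i| <= L) ->
  lebesgue_measure.-integrable setT (EFin \o (fun x => u x * g x)) /\
  \int[lebesgue_measure]_x (u x * g x) =
    c0 * \int[lebesgue_measure]_(x in `[- L, L]) g x +
    \sum_(i < N) c i * \int[lebesgue_measure]_(x in `[y i, L]) g x.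
Proof.
move=> uE cg g0 yL.
have [ig Ig] := Rintegral_support cg g0.
pose f i x := (g \_ `[y i, +oo[) x.
have fE i x : heaviside (x - y i) * g x = f i x.
  rewrite /f patchE /heaviside subr_ge0.
  have -> : (x \in (`[(y i), +oo[%classic : set R)) = (y i <= x).
    by apply/idP/idP; rewrite inE/= in_itv/= andbT.
  by case: ifP; rewrite ?mul1r ?mul0r.
have fint i : lebesgue_measure.-integrable setT (EFin \o f i).
  rewrite /f -restrict_EFin; apply/integrable_restrict => //=.
  by rewrite setTI; apply: integrableS ig.
have fI i : \int[lebesgue_measure]_x f i x = \int[lebesgue_measure]_(x in `[y i, L]) g x.
  rewrite /f -Rintegral_mkcond [LHS]Rintegral_mkcond [RHS]Rintegral_mkcond.
  apply: eq_Rintegral => x _; rewrite !patchE.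
  have -> : (x \in (`[(y i), +oo[%classic : set R)) = (y i <= x).
    by apply/idP/idP; rewrite inE/= in_itv/= andbT.
  have -> : (x \in (`[(y i), L]%classic : set R)) = (y i <= x <= L).
    by apply/idP/idP; rewrite inE/= in_itv/=.
  case: ifPn => //= yx; case: ifPn => // xL.
  by rewrite g0// (lt_le_trans _ (ler_norm _))// ltNge.
have cfint i : lebesgue_measure.-integrable setT (EFin \o (fun x => c i * f i x)).
  by apply: eq_integrable (integrableZl _ (c i) (fint i)) => // z _; rewrite /= EFinM.
have [si sI] := @Rintegral_sum R 'I_N (index_enum 'I_N) xpredT setT
  (fun i x => c i * f i x) measurableT (fun i _ => cfint i).
have i0 : lebesgue_measure.-integrable setT (EFin \o (fun x => c0 * g x)).
  by apply: eq_integrable (integrableZl _ c0 ig) => // z _; rewrite /= EFinM.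
have ugE x : u x * g x = c0 * g x + \sum_(i < N) c i * f i x.
  rewrite uE mulrDl mulr_suml; congr (_ + _); apply: eq_bigr => i _.
  by rewrite -mulrA fE.
split.
  apply: eq_integrable (integrableD _ i0 si) => // x _.
  by rewrite /= ugE EFinD.
under eq_Rintegral do rewrite ugE.
rewrite RintegralD// sI RintegralZl// Ig; congr (_ + _).
by apply: eq_bigr => i _; rewrite RintegralZl// fI.
Qed.

(** The mean value theorem in the first variable replaces differentiability of [F]
    in the pair, so joint continuity is asked of one partial derivative only. *)
Lemma is_derive_moving_bound (R : realType) (F Fy : R -> R -> R) (y : R -> R)
    (t v Ft : R) :
  (forall z s, is_derive z (1 : R) (F ^~ s) (Fy z s)) ->
  continuous (fun p : R * R => Fy p.1 p.2) ->
  is_derive t (1 : R) (F (y t)) Ft -> is_derive t (1 : R) y v ->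
  is_derive t (1 : R) (fun s => F (y s) s) (Fy (y t) t * v + Ft).
Proof.
move=> dF cFy dFt dy; apply/is_derive_cvgP.
have cF s : continuous (F ^~ s).
  move=> z; apply: differentiable_continuous; apply/derivable1_diffP.
  by case: (dF z s).
have /choice[c cP] : forall h, exists c, `|c - y t| <= `|y (t + h) - y t| /\
    F (y (t + h)) (t + h) - F (y t) (t + h) = Fy c (t + h) * (y (t + h) - y t).
  move=> h; have [le|/ltW le] := leP (y t) (y (t + h)).
    have [c] := @MVT_segment R (F ^~ (t + h)) (Fy ^~ (t + h)) _ _ le
      (fun z _ => dF z _) (continuous_subspaceT (cF _)).
    rewrite in_itv/= => /andP[c1 c2] cE; exists c; split => //.
    by rewrite !ger0_norm ?subr_ge0// lerD2r.
  have [c] := @MVT_segment R (F ^~ (t + h)) (Fy ^~ (t + h)) _ _ le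
    (fun z _ => dF z _) (continuous_subspaceT (cF _)).
  rewrite in_itv/= => /andP[c1 c2] cE; exists c; split.
    by rewrite !ler0_norm ?subr_le0// !opprB lerD2l lerN2.
  by rewrite -opprB cE -mulrN opprB.
have h0 : h @[h --> (0 : R)^'] --> (0 : R) by exact: cvg_within.
have th : t + h @[h --> (0 : R)^'] --> t.
  by rewrite -[X in _ --> X]addr0; apply: cvgD; [exact: cvg_cst|exact: h0].
have yc : y (t + h) - y t @[h --> (0 : R)^'] --> (0 : R).
  have cy : {for t, continuous y}.
    by apply: differentiable_continuous; apply/derivable1_diffP; case: dy.
  rewrite -[X in _ --> X](subrr (y t)); apply: cvgB; last exact: cvg_cst.
  exact: (@cvg_comp _ _ _ (fun h => t + h) y _ _ _ th cy).
have cc : c h @[h --> (0 : R)^'] --> y t.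
  apply/subr_cvg0/norm_cvg0P.
  apply: (@squeeze_cvgr _ _ _ _ (cst 0) (fun h => `|y (t + h) - y t|)).
  - by apply: nearW => h /=; rewrite normr_ge0/=; case: (cP h).
  - exact: cvg_cst.
  - by rewrite -[X in _ --> X](@normr0 _ R); exact: cvg_norm.
have Fc : Fy (c h) (t + h) @[h --> (0 : R)^'] --> Fy (y t) t.
  have p : (c h, t + h) @[h --> (0 : R)^'] --> (y t, t) by exact: (cvg_pair cc th).
  exact: (@cvg_comp _ _ _ (fun h => (c h, t + h)) (fun p : R * R => Fy p.1 p.2)
    _ _ _ p (cFy (y t, t))).
have L : Fy (c h) (t + h) * (h^-1 * (y (t + h) - y t)) + h^-1 * (F (y t) (t + h) - F (y t) t)
    @[h --> (0 : R)^'] --> Fy (y t) t * v + Ft.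
  apply: cvgD; last exact/is_derive_cvgP.
  by apply: cvgM => //; exact/is_derive_cvgP.
apply: cvg_trans L; apply: near_eq_cvg; apply: nearW => h.
have [_ cE] := cP h.
have -> : F (y (t + h)) (t + h) - F (y t) t =
    Fy (c h) (t + h) * (y (t + h) - y t) + (F (y t) (t + h) - F (y t) t).
  by rewrite -cE; ring.
ring.
Qed.

(** * Tail integrals of a test function *)

Lemma continuous_box_bounded (R : realType) (g : R -> R -> R) (a b c d : R) :
  continuous (fun p : R * R => g p.1 p.2) ->
  exists C, forall x s, a <= x <= b -> c <= s <= d -> `|g x s| <= C.
Proof.
move=> cg; have [ab|ba] := leP a b; last first.
  by exists 0 => x s /andP[ax xb]; have := le_trans ax xb; rewrite leNgt ba.
have [cd|dc] := leP c d; last first.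
  by exists 0 => x s _ /andP[cs sd]; have := le_trans cs sd; rewrite leNgt dc.
pose A : set (R * R) := `[a, b] `*` `[c, d].
have A0 : A !=set0 by exists (a, c); split; rewrite /= in_itv/= lexx.
have cA : compact A by apply: compact_setX; exact: segment_compact.
have cn : {within A, continuous (fun p : R * R => `|g p.1 p.2|)}.
  by apply: continuous_subspaceT => p; apply: cvg_norm; exact: cg.
have [p _ hp] := compact_EVT_max A0 cA cn.
exists `|g p.1 p.2| => x s xab scd; apply: (hp (x, s)).
by rewrite inE; split; rewrite /= in_itv.
Qed.

Lemma slice_continuous (R : realType) (g : R -> R -> R) (s : R) :
  continuous (fun p : R * R => g p.1 p.2) -> continuous (g ^~ s).
Proof.
move=> cg x; have p : (z, s) @[z --> x] --> (x, s).
  have h1 : z @[z --> x] --> x by exact: cvg_id.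
  have h2 : s @[z --> x] --> s by exact: cvg_cst.
  exact: (cvg_pair h1 h2).
exact: (@cvg_comp _ _ _ (fun z => (z, s)) (fun p : R * R => g p.1 p.2) _ _ _ p (cg (x, s))).
Qed.

Section tail.
Context (R : realType) (L : R).

(** For [y <= L] this is the integral of [g ^~ s] over [[y, L]]; with signed
    primitives it is differentiable in [y] without restriction. *)
Definition tail (g : R -> R -> R) (y s : R) : R :=
  primitive (g ^~ s) L - primitive (g ^~ s) y.

Lemma tailE (g : R -> R -> R) (y s : R) :
  continuous (fun p : R * R => g p.1 p.2) -> y <= L ->
  tail g y s = \int[lebesgue_measure]_(z in `[y, L]) g z s.
Proof.
move=> cg yL; rewrite /tail primitiveB//.
exact/continuous_integrable_on_segments/slice_continuous.
Qed.

Lemma tail_is_derive_bound (g : R -> R -> R) (y s : R) :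
  continuous (fun p : R * R => g p.1 p.2) ->
  is_derive y (1 : R) (tail g ^~ s) (- g y s).
Proof.
move=> cg; have d := primitive_is_derive y (@slice_continuous R g s cg).
have := is_deriveB (is_derive_cst (primitive (g ^~ s) L) y (1 : R)) d.
by rewrite sub0r.
Qed.

Lemma tail_is_derive_time (g : R -> R -> R) (y s : R) :
  continuous (fun p : R * R => g p.1 p.2) ->
  continuous (fun p : R * R => dt g p.1 p.2) ->
  (forall z r, derivable (g z) r 1) -> y <= L ->
  is_derive s (1 : R) (tail g y) (tail (dt g) y s).
Proof.
move=> cg cdg dg yL; rewrite (@tailE (dt g) y s cdg yL).
have [C hC] := continuous_box_bounded y L (s - 1) (s + 1) cdg.
have C0 : 0 <= `|C| by [].
have s1 : s - 1 < s < s + 1 by apply/andP; split; lra.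
have Is : `](s - 1), (s + 1)[%classic s by rewrite /= in_itv.
have mB : measurable (`[y, L]%classic : set (measurableTypeR R)) by exact: measurable_itv.
have int r : `](s - 1), (s + 1)[%classic r ->
    lebesgue_measure.-integrable `[y, L] (EFin \o (fun z => g z r)).
  by move=> _; exact/continuous_integrable_on_segments/slice_continuous.
have der r z : `](s - 1), (s + 1)[%classic r -> `[y, L]%classic z ->
    derivable ((fun r z => g z r) ^~ z) r 1 by move=> _ _; exact: dg.
have intC : lebesgue_measure.-integrable `[y, L] (EFin \o (fun=> `|C|)).
  apply: (@continuous_compact_integrable R (cst `|C|)); first exact: segment_compact.
  exact: cst_continuous.
have bnd r z : `](s - 1), (s + 1)[%classic r -> `[y, L]%classic z ->
    `|partial1of2 (fun r z => g z r) r z| <= `|C|.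
  rewrite /= !in_itv/= => /andP[r1 r2] zI.
  by apply: le_trans (ler_norm C); apply: hC; rewrite ?zI// !ltW.
have D1 := @derivable_under_integral _ _ _ lebesgue_measure (fun r z => g z r) _ mB _ _ _ Is int der
  (fun=> `|C|) (fun=> C0) intC bnd.
have D2 := @differentiation_under_integral _ _ _ lebesgue_measure (fun r z => g z r) _ mB _ _ _ Is int der
  (fun=> `|C|) (fun=> C0) intC bnd.
have E : tail g y = (fun r => \int[lebesgue_measure]_(z in `[y, L]) g z r).
  by apply/funext => r; rewrite tailE.
rewrite E; exact: is_derive_derive1 D1 D2.
Qed.

Lemma tail_bounded (g : R -> R -> R) (C y s : R) :
  continuous (fun p : R * R => g p.1 p.2) -> - L <= y <= L ->
  (forall z, - L <= z <= L -> `|g z s| <= C) -> `|tail g y s| <= C * (2 * L).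
Proof.
move=> cg /andP[Ly yL] hC.
have C0 : 0 <= C by apply: le_trans (hC y _); rewrite ?Ly.
have cgs := @slice_continuous R g s cg.
have := @mean_value_inequality_except R (tail g ^~ s) (fun z => - g z s) [::] C y L yL.
have E0 : tail g L s = 0 by rewrite /tail subrr.
rewrite E0 sub0r normrN => h.
have {}h : `|tail g y s| <= C * (L - y).
  apply: h.
    apply: derivable_within_continuous => z _.
    by case: (@tail_is_derive_bound g z s cg).
  move=> z /andP[yz zL] _; rewrite normrN; split; first exact: tail_is_derive_bound.
  by apply: hC; apply/andP; split; lra.
by apply: le_trans h _; rewrite ler_wpM2l//; lra.
Qed.

Lemma tail_path_continuous (g : R -> R -> R) (C : R) (y : R -> R) :
  continuous (fun p : R * R => g p.1 p.2) ->
  continuous (fun p : R * R => dt g p.1 p.2) ->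
  (forall z r, derivable (g z) r 1) -> (forall z r, `|g z r| <= C) ->
  (forall r, y r <= L) -> continuous y -> continuous (fun r => tail g (y r) r).
Proof.
move=> cg cdg dg hC yL cy s.
have lip r : `|tail g (y r) r - tail g (y s) r| <= C * `|y r - y s|.
  have mv a b : a <= b -> `|tail g b r - tail g a r| <= C * (b - a).
    move=> ab; apply: (@mean_value_inequality_except R (tail g ^~ r) (fun z => - g z r) [::]) => //.
      apply: derivable_within_continuous => z _.
      by case: (@tail_is_derive_bound g z r cg).
    by move=> z _ _; rewrite normrN; split => //; exact: tail_is_derive_bound.
  have [le|/ltW le] := leP (y s) (y r); first by rewrite (@ger0_norm _ (y r - y s)) ?subr_ge0// mv.
  by rewrite distrC (distrC (y r)) (@ger0_norm _ (y s - y r)) ?subr_ge0// mv.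
have L1 : tail g (y r) r - tail g (y s) r @[r --> s] --> (0 : R).
  apply/norm_cvg0P; apply: (@squeeze_cvgr _ _ _ _ (cst 0) (fun r => C * `|y r - y s|)).
  - by apply: nearW => r /=; rewrite normr_ge0/=; exact: lip.
  - exact: cvg_cst.
  - rewrite -[X in _ --> X](mulr0 C); apply: cvgM; first exact: cvg_cst.
    rewrite -[X in _ --> X](@normr0 _ R); apply: cvg_norm.
    by rewrite -[X in _ --> X](subrr (y s)); apply: cvgB; [exact: cy|exact: cvg_cst].
have L2 : {for s, continuous (tail g (y s))}.
  apply: differentiable_continuous; apply/derivable1_diffP.
  by case: (@tail_is_derive_time g (y s) s cg cdg dg (yL s)).
have L3 : (tail g (y r) r - tail g (y s) r) + tail g (y s) r @[r --> s]
    --> tail g (y s) s by rewrite -[X in _ --> X]add0r; exact: cvgD L1 L2.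
apply: cvg_trans L3; apply: near_eq_cvg; apply: nearW => r.
by rewrite /= subrK.
Qed.

Lemma tail_path_is_derive (g : R -> R -> R) (y : R -> R) (s v : R) :
  continuous (fun p : R * R => g p.1 p.2) ->
  continuous (fun p : R * R => dt g p.1 p.2) ->
  (forall z r, derivable (g z) r 1) -> y s <= L -> is_derive s (1 : R) y v ->
  is_derive s (1 : R) (fun r => tail g (y r) r) (- g (y s) s * v + tail (dt g) (y s) s).
Proof.
move=> cg cdg dg yL dy.
apply: (@is_derive_moving_bound R (tail g) (fun z r => - g z r)) => //.
- by move=> z r; exact: tail_is_derive_bound.
- by move=> p; apply: cvgN; exact: cg.
- exact: tail_is_derive_time.
Qed.

End tail.

(** * The entropy inequality *)

Lemma is_derive_rsum (R : realType) (I : Type) (r : seq I) (f : I -> R -> R)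
    (d : I -> R) (t : R) :
  (forall i, is_derive t (1 : R) (f i) (d i)) ->
  is_derive t (1 : R) (fun s => \sum_(i <- r) f i s) (\sum_(i <- r) d i).
Proof.
move=> df; apply/is_derive_cvgP.
have L : \sum_(i <- r) (h^-1 * (f i (t + h) - f i t)) @[h --> (0 : R)^'] --> \sum_(i <- r) d i.
  by apply: cvg_rsum => i _; exact/is_derive_cvgP.
apply: cvg_trans L; apply: near_eq_cvg; apply: nearW => h.
by rewrite -mulr_sumr sumrB.
Qed.

Lemma compact_norm_bounded (R : realType) (K : set R) : compact K ->
  exists2 L, 0 < L & forall z, K z -> `|z| <= L.
Proof.
move=> /compact_bounded bK.
have : \forall L \near +oo, 0 < L /\ forall z, K z -> `|z| <= L.
  near=> L; split; first by near: L; exact: nbhs_pinfty_gt.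
  by near: L; exact: bK.
by move=> /filter_ex[L [L0 hL]]; exists L.
Unshelve. all: by end_near. Qed.

Section test_function2.
Context (R : realType) (T : R) (zeta : R -> R -> R)
  (hz : nonneg_test_function2 T zeta).

Lemma test2_continuous : continuous (fun p : R * R => zeta p.1 p.2).
Proof. by have [/(_ 0%N)[]] := hz. Qed.

Lemma test2_dx_continuous : continuous (fun p : R * R => dx zeta p.1 p.2).
Proof. by have [/(_ 1%N)[_ [_ _ [] ]]] := hz. Qed.

Lemma test2_dt_continuous : continuous (fun p : R * R => dt zeta p.1 p.2).
Proof. by have [/(_ 1%N)[_ [_ _ _ [] ]]] := hz. Qed.

Lemma test2_derivable_x (z s : R) : derivable (fun y => zeta y s) z 1.
Proof. by have [/(_ 1%N)[_ [h _ _ _]] _ _] := hz; exact: h. Qed.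

Lemma test2_derivable_t (z s : R) : derivable (zeta z) s 1.
Proof. by have [/(_ 1%N)[_ [_ h _ _]] _ _] := hz; exact: h. Qed.

Lemma test2_ge0 (z s : R) : 0 <= zeta z s.
Proof. by have [_ + _] := hz; apply. Qed.

Lemma test2_time (z s : R) : ~~ (0 < s < T) -> zeta z s = 0.
Proof.
have [_ _ [K [_ KT K0]]] := hz => sT; apply: K0 => /KT /=; exact/negP.
Qed.

Lemma test2_space : exists2 L, 0 < L & forall z s, L < `|z| -> zeta z s = 0.
Proof.
have [_ _ [K [cK _ K0]]] := hz.
have cK1 : compact (fst @` K).
  by apply: continuous_compact => //; apply: continuous_subspaceT => p; exact: cvg_fst.
have [L L0 hL] := compact_norm_bounded cK1.
exists L => // z s Lz; apply: K0 => Kzs; move: Lz; rewrite ltNge => /negP; apply.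
by apply: hL; exists (z, s).
Qed.

Lemma test2_dt0 (z : R) : (forall s, zeta z s = 0) -> forall s, dt zeta z s = 0.
Proof.
move=> z0 s; rewrite /dt (_ : zeta z = cst 0); first by rewrite derive1_cst.
exact/funext.
Qed.

Lemma test2_dx0 (L z : R) : (forall y s, L < `|y| -> zeta y s = 0) ->
  L < `|z| -> forall s, dx zeta z s = 0.
Proof.
move=> z0 Lz s; rewrite /dx derive1E.
rewrite (@near_eq_derive R R R _ (cst 0)); first by rewrite derive_cst.
near=> y; rewrite /= z0//.
near: y; apply: (cvgr_gt _ _ _ Lz).
by apply: cvg_norm; exact: cvg_id.
Unshelve. all: by end_near. Qed.

Lemma test2_bounded : exists C, forall z s, `|zeta z s| <= C.
Proof.
have [L L0 hL] := test2_space.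
have [C hC] := continuous_box_bounded (- L) L 0 T test2_continuous.
exists (Num.max C 0) => z s; rewrite le_max.
have [sT|/test2_time ->] := boolP (0 < s < T); last by rewrite normr0 lexx orbT.
have [zL|/hL ->] := leP `|z| L; last by rewrite normr0 lexx orbT.
have /andP[s0 s1] := sT.
by rewrite hC -?ler_norml// !ltW.
Qed.

End test_function2.

Section main.
Context (R : realType) (phi : R -> R) (hphi : protocol phi) (N : nat)
  (m x0 v0 psi0 : 'I_N -> R) (hm : forall i, 0 < m i)
  (hm1 : \sum_(j < N) m j = 1) (A : R -> R)
  (hA : forall (i : 'I_N) y,
    theta m i < y < theta m i.+1 -> derive1 A y = psi0 i)
  (hA2 : forall i : 'I_N, A (theta m i.+1) - A (theta m i) = m i * psi0 i)
  (hv0 : forall i,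
     v0 i = psi0 i - \sum_(j < N) m j * primitive phi (x0 i - x0 j))
  (x v : 'I_N -> R -> R) (hxv : sticky_dynamics phi m x0 v0 x v).

Local Notation psi := (flux_slope phi m x v).
Local Notation M := (fun y t => step_profile m (fun i => x i t) y).

Let ordered t : 0 <= t -> forall i j : 'I_N, (i <= j)%N -> x i t <= x j t.
Proof. by move=> t0 i j ij; exact: (sticky_ordered hxv). Qed.

Let inv t : 0 <= t -> slope_invariant phi m psi0 x v t.
Proof. exact: (slope_invariant_holds hphi hm hv0 hxv). Qed.

(** The right-hand side is the polygon of [slope_defect], read at a saturated
    index. *)
Lemma flux_of_profile (y t : R) : 0 <= t ->
  A (M y t) = A (- 2^-1) + \sum_(i < N) m i * psi i t * heaviside (y - x i t).
Proof.
move=> t0; rewrite (comp_step_profile m (ordered t0)); congr (_ + _).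
have [k kN hk] := sorted_le_prefix (ordered t0) y.
rewrite !(sum_heaviside _ hk).
have sat : saturated (x ^~ t) k.
  move=> i j /andP[ik kj]; rewrite gt_eqF//.
  apply: (@le_lt_trans _ _ y); first by rewrite hk.
  by rewrite ltNge hk -leqNgt.
have := invariant_eq0 (inv t0) sat; rewrite /slope_defect => D0.
apply/eqP; rewrite -subr_eq0 -sumrB; apply/eqP; rewrite -[RHS]D0.
by apply: eq_bigr => i _; rewrite hA2 mulrBr.
Qed.

Section pair.
Context (eta q : R -> R) (hpair : entropy_pair A eta q).

Let deta (i : 'I_N) := eta (theta m i.+1) - eta (theta m i).

Let theta_lt (i : 'I_N) : theta m i < theta m i.+1.
Proof. by rewrite thetaS ltrDl. Qed.

Let theta_itv (k : nat) : (k <= N)%N -> - 2^-1 <= theta m k <= 2^-1.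
Proof. exact: theta_bounds. Qed.

Let flux_increment (i : 'I_N) :
  q (theta m i.+1) - q (theta m i) = psi0 i * deta i.
Proof.
have /andP[a1 _] := theta_itv (ltnW (ltn_ord i)).
have /andP[_ b1] := theta_itv (ltn_ord i).
exact: (entropy_flux_increment hpair a1 (theta_lt i) b1 (@hA i)).
Qed.

(** Abel summation against the defect: the slopes of [eta] grow with the index
    because [eta] is convex, and where the weight [z] may change between
    neighbours the defect vanishes. *)
Let dissipation_ge0 (z : 'I_N -> R) (t : R) : 0 <= t -> (forall i, 0 <= z i) ->
  (forall i j, x i t = x j t -> z i = z j) ->
  0 <= \sum_(i < N) z i * deta i * (psi i t - psi0 i).
Proof.
move=> t0 z0 zE; have [i2 i3 _] := inv t0.
rewrite (_ : \sum_(i < N) _ = - \sum_(i < N) (z i * (deta i / m i)) * (m i * (psi0 i - psi i t))).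
  rewrite oppr_ge0; apply: abel_le0.
  - exact: i2.
  - by apply: i3 => i j /andP[_]; rewrite leqNgt ltn_ord.
  - move=> i j ji; have ij : (i <= j)%N by rewrite ji.
    have := ordered t0 ij; rewrite le_eqVlt => /predU1P[xij|xij]; [right|left].
      rewrite (zE _ _ xij); apply: ler_wpM2l => //.
      have [hc _ _ _] := hpair.
      have /andP[a1 _] := theta_itv (ltnW (ltn_ord i)).
      have /andP[_ b1] := theta_itv (ltn_ord j).
      have dth (l : 'I_N) : theta m l.+1 - theta m l = m l by rewrite thetaS addrAC subrr add0r.
      have ej : theta m i.+1 = theta m j by rewrite ji.
      have lt2 : theta m i.+1 < theta m j.+1 by rewrite ej.
      have := convex_slope_le hc a1 (theta_lt i) lt2 b1.
      by rewrite /deta dth !ej dth.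
    apply: i3 => a b /andP[aj jb]; rewrite gt_eqF//.
    apply: (@le_lt_trans _ _ (x i t)); first by apply: ordered => //; rewrite -ltnS -ji.
    by apply: (lt_le_trans xij); exact: ordered.
rewrite -sumrN; apply: eq_bigr => i _; field; rewrite gt_eqF//.
Qed.

Definition positive_jumps (t : R) := atoms deta (x ^~ t).
Definition negative_jumps (t : R) := atoms (fun i => - deta i) (x ^~ t).

Let jumps_integral (g : R -> R) (t : R) : continuous g ->
  \int[positive_jumps t]_y g y - \int[negative_jumps t]_y g y =
  \sum_(i < N) deta i * g (x i t).
Proof.
move=> cg; have mg := continuous_measurable_fun cg.
rewrite !atoms_Rintegral// -sumrB; apply: eq_bigr => i _.
rewrite -mulrBl; congr (_ * _).
by case: (leP 0 (deta i)) => ?; case: (leP 0 (- deta i)) => ?; lra.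
Qed.

Lemma radon_jumps (t : R) : 0 <= t ->
  radon_derivative (fun y => eta (M y t)) (positive_jumps t) (negative_jumps t).
Proof.
move=> t0; split; first by move=> K _; split; exact: atoms_fin.
move=> g [gsmooth [K cK gK]].
have dg y : derivable g y 1 := gsmooth 0%N y.
have cg' : continuous (derive1 g).
  move=> y; apply: differentiable_continuous; apply/derivable1_diffP.
  exact: (gsmooth 1%N y).
have cg : continuous g.
  by move=> y; apply: differentiable_continuous; apply/derivable1_diffP.
have [L1 L10 hL1] := compact_norm_bounded cK.
have g0 y : L1 < `|y| -> g y = 0.
  by move=> Ly; apply: gK => /hL1; rewrite leNgt Ly.
pose L := L1 + 1 + \sum_(i < N) `|x i t|.
have L1L : L1 < L by rewrite /L -addrA ltrDl ltr_pwDl// sumr_ge0.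
have L0 : 0 < L by exact: lt_trans L1L.
have xL i : `|x i t| <= L.
  rewrite /L (bigD1 i)//= addrCA lerDl addr_ge0 ?sumr_ge0//.
  by rewrite addr_ge0// ltW.
have g'0 y : L < `|y| -> derive1 g y = 0.
  move=> Ly; rewrite derive1E (@near_eq_derive R R R _ (cst 0)) ?derive_cst//.
  near=> z; rewrite /= g0//; apply: (lt_trans L1L).
  by near: z; apply: (cvgr_gt _ _ _ Ly); apply: cvg_norm; exact: cvg_id.
have tailg a : - L <= a <= L ->
    \int[lebesgue_measure]_(y in `[a, L]) derive1 g y = - g a.
  move=> /andP[_ aL]; transitivity (g L - g a); last by rewrite g0 ?sub0r// gtr0_norm.
  have dg' y : a < y < L -> is_derive y (1 : R) g (derive1 g y).
    by move=> _; exact: is_derive_derive1.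
  exact: (Rintegral_FTC2 aL (continuous_subspaceT cg') (continuous_subspaceT cg) dg').
rewrite (Rintegral_step_function (comp_step_profile m (ordered t0) eta) cg' g'0 xL).2.
rewrite tailg; last by rewrite lexx/=; lra.
rewrite [g (- L)]g0; last by rewrite normrN gtr0_norm.
rewrite jumps_integral// oppr0 mulr0 add0r -sumrN; apply: eq_bigr => i _.
by rewrite tailg -?ler_norml// mulrN.
Unshelve. all: by end_near. Qed.

Section horizon.
Context (T : R) (T0 : 0 < T) (RT : R) (RT0 : 0 < RT)
  (xRT : forall i t, 0 <= t <= T -> `|x i t| <= RT).

Context (zeta : R -> R -> R) (hz : nonneg_test_function2 T zeta).

Let xc i := x i \o clamp 0 T.

Let xc_continuous i : continuous (xc i).
Proof. by apply: (position_clamp_continuous hxv) => //; exact: ltW. Qed.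

Let xcE i t : 0 <= t <= T -> xc i t = x i t.
Proof. by move=> tT; rewrite /xc /= clamp_id. Qed.

Let drift i t := \sum_(j < N) m j * primitive phi (xc i t - xc j t).

Let drift_continuous i : continuous (drift i).
Proof.
move=> t; apply: cvg_rsum => j _; apply: cvgM; first exact: cvg_cst.
have h : xc i s - xc j s @[s --> t] --> xc i t - xc j t by apply: cvgB; exact: xc_continuous.
exact: (@cvg_comp _ _ _ (fun s => xc i s - xc j s) (primitive phi) _ _ _ h
  (@protocol_primitive_continuous R phi hphi (xc i t - xc j t))).
Qed.

Let driftE i t : 0 <= t <= T -> psi i t = v i t + drift i t.
Proof.
move=> tT; rewrite /flux_slope /drift; congr (_ + _); apply: eq_bigr => j _.
by rewrite !xcE.
Qed.

(** The first summand is the time derivative of the integral of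
    [eta (M t) * zeta t]; it contains the transport of the jumps at the speeds
    [v i]. The convolution turns these speeds into the slopes [psi i], and the
    entropy flux turns them into the differences [psi i - psi0 i]. *)
Let production_split (L t : R) : RT <= L -> (forall z s, L < `|z| -> zeta z s = 0) ->
  zeta L t = 0 -> zeta (- L) t = 0 -> 0 < t < T ->
  entropy_production (fun z s => convolution phi RT (M ^~ s) z) eta q M
    positive_jumps negative_jumps zeta t =
  (eta (- 2^-1) * tail L (dt zeta) (- L) t +
   \sum_(i < N) deta i * (- zeta (x i t) t * v i t + tail L (dt zeta) (x i t) t)) +
  \sum_(i < N) zeta (x i t) t * deta i * (psi i t - psi0 i).
Proof.
move=> RTL zL zLt zNLt /andP[t_gt0 tT].
have t0 : 0 <= t by exact: ltW.
have tI : 0 <= t <= T by rewrite t0 ltW.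
have L0 : 0 < L by exact: lt_le_trans RTL.
have LL : - L <= - L <= L by rewrite lexx/=; lra.
have xL i : `|x i t| <= L by exact: le_trans (xRT i tI) RTL.
have cdt := test2_dt_continuous hz.
have cdx := test2_dx_continuous hz.
have dt0 z : L < `|z| -> dt zeta z t = 0.
  by move=> Lz; apply: test2_dt0 => s; exact: zL.
have dx0 z : L < `|z| -> dx zeta z t = 0.
  by move=> Lz; exact: (test2_dx0 zL).
have [i1 I1] := Rintegral_step_function (comp_step_profile m (ordered t0) eta)
  (slice_continuous (s := t) cdt) dt0 xL.
have [i2 I2] := Rintegral_step_function (comp_step_profile m (ordered t0) q)
  (slice_continuous (s := t) cdx) dx0 xL.
have tdx a : - L <= a <= L -> \int[lebesgue_measure]_(z in `[a, L]) dx zeta z t = - zeta a t.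
  move=> /andP[_ aL]; transitivity (zeta L t - zeta a t); last by rewrite zLt sub0r.
  have dz z : a < z < L -> is_derive z (1 : R) (zeta ^~ t) (dx zeta z t).
    by move=> _; apply: is_derive_derive1 => //; exact: (test2_derivable_x hz).
  exact: (Rintegral_FTC2 aL
    (continuous_subspaceT (slice_continuous (s := t) cdx))
    (continuous_subspaceT (slice_continuous (s := t) (test2_continuous hz))) dz).
have convE z : convolution phi RT (M ^~ t) z = \sum_(j < N) m j * primitive phi (z - x j t).
  by apply: convolution_step_profile => // j; exact: xRT.
have cconv : continuous (fun z => zeta z t * convolution phi RT (M ^~ t) z).
  move=> z; apply: cvgM; first exact: (slice_continuous (test2_continuous hz)).
  rewrite convE (_ : convolution phi RT (M ^~ t) =
    (fun z => \sum_(j < N) m j * primitive phi (z - x j t))); last exact/funext.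
  apply: cvg_rsum => j _; apply: cvgM; first exact: cvg_cst.
  have h : y - x j t @[y --> z] --> z - x j t by apply: cvgB; [exact: cvg_id|exact: cvg_cst].
  exact: (@cvg_comp _ _ _ (fun y => y - x j t) (primitive phi) _ _ _ h
    (@protocol_primitive_continuous R phi hphi (z - x j t))).
have xLL i : - L <= x i t <= L by rewrite -ler_norml.
have I2' : \int[lebesgue_measure]_z (q (M z t) * dx zeta z t) =
    \sum_(i < N) (q (theta m i.+1) - q (theta m i)) * - zeta (x i t) t.
  rewrite I2 (tdx _ LL) zNLt oppr0 mulr0 add0r; apply: eq_bigr => i _.
  by rewrite (tdx _ (xLL i)).
have tdt a : - L <= a <= L ->
    \int[lebesgue_measure]_(z in `[a, L]) dt zeta z t = tail L (dt zeta) a t.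
  by move=> /andP[_ aL]; rewrite tailE.
have I1' : \int[lebesgue_measure]_z (eta (M z t) * dt zeta z t) =
    eta (- 2^-1) * tail L (dt zeta) (- L) t + \sum_(i < N) deta i * tail L (dt zeta) (x i t) t.
  rewrite I1 (tdt _ LL); congr (_ + _).
  apply: eq_bigr => i _; by rewrite (tdt _ (xLL i)).
rewrite /entropy_production RintegralD// I1' I2' (jumps_integral t cconv).
rewrite -!addrA; congr (_ + _); rewrite -!big_split/=; apply: eq_bigr => i _.
rewrite flux_increment convE /flux_slope; ring.
Qed.

(** The transport part integrates to [0] because the test function vanishes at
    the ends of the time interval, and the dissipation is nonnegative. *)
Lemma entropy_inequality :
  let c z s := convolution phi RT (M ^~ s) z in
  lebesgue_measure.-integrable `]0, T[
    (EFin \o entropy_production c eta q M positive_jumps negative_jumps zeta) /\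
  0 <= \int[lebesgue_measure]_(t in `]0, T[)
         entropy_production c eta q M positive_jumps negative_jumps zeta t.
Proof.
move=> c.
have [L1 L10 zL1] := test2_space hz.
pose L := L1 + RT.
have L1L : L1 < L by rewrite /L ltrDl.
have RTL : RT <= L by rewrite /L lerDr ltW.
have L0 : 0 < L by exact: lt_le_trans RTL.
have zL z s : L < `|z| -> zeta z s = 0 by move=> Lz; apply: zL1; exact: lt_trans Lz.
have zLt s : zeta L s = 0 by apply: zL1; rewrite gtr0_norm.
have zNLt s : zeta (- L) s = 0 by apply: zL1; rewrite normrN gtr0_norm.
have cz := test2_continuous hz.
have cdt := test2_dt_continuous hz.
have dz := test2_derivable_t hz.
have xcRT i t : `|xc i t| <= RT by apply: xRT; apply: clamp_itv; exact: ltW.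
have xcL i t : - L <= xc i t <= L by rewrite -ler_norml (le_trans (xcRT i t)).
pose transport t := eta (- 2^-1) * tail L (dt zeta) (- L) t +
   \sum_(i < N) deta i * (- zeta (x i t) t * v i t + tail L (dt zeta) (x i t) t).
pose dissipation t := \sum_(i < N) zeta (x i t) t * deta i * (psi i t - psi0 i).
pose energy t := eta (- 2^-1) * tail L zeta (- L) t + \sum_(i < N) deta i * tail L zeta (xc i t) t.
have [S hS] : exists S : seq R, forall t, collision_time x t -> t \in S.
  have /finite_seqP[S SE] := finite_collision_times hxv.
  by exists S => t ct; have : [set t | collision_time x t] t by []; rewrite SE.
have [Cz hCz] := test2_bounded hz.
have [Cd hCd] := continuous_box_bounded (- L) L 0 T cdt.
have [B hB] : exists B, forall j, `|psi0 j| <= B.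
  exists (\sum_(j < N) `|psi0 j|) => j.
  by rewrite (bigD1 j)//= lerDl sumr_ge0.
have dr_bnd i : exists D, forall t, 0 <= t <= T -> `|drift i t| <= D.
  exact: continuous_segment_bounded.
have [D hD] := choice dr_bnd.
have psiB i t : 0 <= t <= T -> `|psi i t| <= B.
  by move=> /andP[t0 _]; exact: (invariant_bound (inv t0) hB).
have vB i t : 0 <= t <= T -> `|v i t| <= B + D i.
  move=> tT; have -> : v i t = psi i t - drift i t by rewrite driftE// addrK.
  apply: le_trans (ler_normB _ _) _; apply: lerD; [exact: psiB|exact: hD].
have c_energy : continuous energy.
  move=> t; apply: cvgD.
    apply: cvgM; first exact: cvg_cst.
    apply: (@tail_path_continuous R L zeta Cz (fun=> - L)) => //.
      by move=> _; lra.
    exact: cst_continuous.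
  apply: cvg_rsum => i _; apply: cvgM; first exact: cvg_cst.
  apply: (@tail_path_continuous R L zeta Cz (xc i)) => //.
  by move=> s; have /andP[] := xcL i s.
pose C := `|eta (- 2^-1)| * (Cd * (2 * L)) +
  \sum_(i < N) `|deta i| * (Cz * (B + D i) + Cd * (2 * L)).
have transportB t : 0 < t < T -> t \notin S ->
    is_derive t (1 : R) energy (transport t) /\ `|transport t| <= C.
  move=> /andP[t0 tT] tS; have tI : 0 <= t <= T by rewrite !ltW.
  have nc : ~ collision_time x t by move=> /hS; exact/negP.
  split.
    apply: is_deriveD.
      apply: is_deriveZ.
      have := @tail_path_is_derive R L zeta (fun=> - L) t 0 cz cdt dz.
      by rewrite mulr0 add0r; apply; lra.
    apply: is_derive_rsum => i; apply: is_deriveZ.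
    rewrite -(xcE i tI).
    apply: (@tail_path_is_derive R L zeta (xc i)) => //.
      by have /andP[] := xcL i t.
    apply: clamp_is_derive; first by rewrite t0.
    exact: (sticky_pos_ode hxv).
  have tailB a : - L <= a <= L -> `|tail L (dt zeta) a t| <= Cd * (2 * L).
    by move=> aL; apply: tail_bounded => // z zI; exact: hCd.
  apply: le_trans (ler_normD _ _) _; apply: lerD.
    by rewrite normrM ler_wpM2l// tailB// lexx/=; lra.
  apply: le_trans (ler_norm_sum _ _ _) _; apply: ler_sum => i _.
  rewrite normrM ler_wpM2l//; apply: le_trans (ler_normD _ _) _; apply: lerD.
    by rewrite normrM normrN ler_pM// vB.
  by apply: tailB; rewrite -(xcE i tI).
have [it It] := FTC_except T0 (continuous_subspaceT c_energy) transportB.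
have energy0 s : ~~ (0 < s < T) -> energy s = 0.
  move=> sT; have tail0 a : tail L zeta a s = 0.
    have p0 b : primitive (zeta ^~ s) b = 0.
      rewrite (_ : zeta ^~ s = cst 0); last by apply/funext => z; exact: (test2_time hz).
      by rewrite /primitive /= !Rintegral_cst// !mul0r oppr0; case: ifP.
    by rewrite /tail !p0 subrr.
  rewrite /energy tail0 mulr0 add0r big1// => i _.
  by rewrite tail0 mulr0.
rewrite !energy0 ?ltxx ?andbF// subrr in It.
have diss_ge0 t : 0 <= t -> 0 <= dissipation t.
  move=> t0; apply: dissipation_ge0 => // [i|i j ->//].
  exact: (test2_ge0 hz).
have idiss : lebesgue_measure.-integrable `]0, T[ (EFin \o dissipation).
  have fin : (lebesgue_measure (`]0%R, T[%classic : set R) < +oo)%E.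
    by rewrite lebesgue_measure_itv/= lte_fin T0 -EFinB ltry.
  apply: (measurable_bounded_integrable _ fin) => //.
  - apply: (@eq_measurable_fun _ _ _ _ _ (fun t => \sum_(i < N)
      zeta (xc i t) t * deta i * (v i t + drift i t - psi0 i))).
      move=> t; rewrite inE/= in_itv/= => /andP[t0 tT].
      have tI : 0 <= t <= T by rewrite !ltW.
      by apply: eq_bigr => i _; rewrite xcE// driftE.
    apply: measurable_sum => i; apply: measurable_funM.
      apply: measurable_funTS; apply: continuous_measurable_fun => t.
      apply: cvgM; last exact: cvg_cst.
      have h1 : xc i s @[s --> t] --> xc i t by exact: xc_continuous.
      have h2 : s @[s --> t] --> t by exact: cvg_id.
      have p : (xc i s, s) @[s --> t] --> (xc i t, t) by exact: (cvg_pair h1 h2).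
      exact: (@cvg_comp _ _ _ (fun s => (xc i s, s)) (fun p : R * R => zeta p.1 p.2)
        _ _ _ p (cz (xc i t, t))).
    apply: measurable_funB; last exact: measurable_cst.
    apply: measurable_funD; last first.
      by apply: measurable_funTS; exact: continuous_measurable_fun.
    apply: (@derivative_measurable_except R (xc i) (v i) S) => //.
      exact: continuous_subspaceT.
    move=> t t0T tS; apply: clamp_is_derive => //.
    apply: (sticky_pos_ode hxv); first by case/andP: t0T.
    by move=> /hS; exact/negP.
  - exists (\sum_(i < N) Cz * `|deta i| * (B + B)); split; first exact: num_real.
    move=> K CK t /=; rewrite in_itv/= => /andP[t0 tT]; apply: le_trans (ltW CK).
    have tI : 0 <= t <= T by rewrite !ltW.
    apply: le_trans (ler_norm_sum _ _ _) _; apply: ler_sum => i _.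
    rewrite 2!normrM; apply: ler_pM => //.
      by rewrite ler_wpM2r.
    by apply: le_trans (ler_normB _ _) _; apply: lerD; [exact: psiB|exact: hB].
have E t : `]0, T[%classic t ->
    entropy_production c eta q M positive_jumps negative_jumps zeta t = transport t + dissipation t.
  by rewrite /= in_itv/= => tT; rewrite (@production_split L).
split.
  apply: eq_integrable (integrableD _ it idiss) => // t; rewrite inE => tT.
  by rewrite /= E// EFinD.
have -> : \int[lebesgue_measure]_(t in `]0, T[)
      entropy_production c eta q M positive_jumps negative_jumps zeta t =
    \int[lebesgue_measure]_(t in `]0, T[) (transport t + dissipation t).
  by apply: eq_Rintegral => t; rewrite inE => tT; exact: E.
rewrite RintegralD// It add0r; apply: Rintegral_ge0 => t.
by rewrite /= in_itv/= => /andP[t0 _]; apply/diss_ge0/ltW.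
Qed.

End horizon.

End pair.
End main.

(** * Conclusion *)

Lemma affine_piece_increment (R : realType) (A : R -> R) (a b p : R) : a < b ->
  (exists c d : R, forall y, a <= y <= b -> A y = c * y + d) ->
  (forall y, a < y < b -> derive1 A y = p) -> A b - A a = (b - a) * p.
Proof.
move=> ab [c [d Acd]] dA; pose y := (a + b) / 2.
have yI : a < y < b by apply/andP; split; rewrite /y; lra.
have dAc : is_derive y (1 : R) A c.
  apply: (@near_eq_is_derive _ _ _ (fun z => c * z + d)).
    near=> z; rewrite Acd//; have : z \in `]a, b[%R.
      by near: z; apply: near_in_itvoo; rewrite in_itv.
    by rewrite in_itv/= => /andP[az zb]; rewrite !ltW.
  have h := is_deriveD (is_deriveZ c (is_derive_id y (1 : R))) (is_derive_cst d y (1 : R)).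
  by move: h; rewrite addr0 /GRing.scale/= mulr1.
have -> : p = c by rewrite -(dA y yI) derive1E; case: dAc.
by rewrite !Acd ?lexx ?ltW//; ring.
Unshelve. all: by end_near. Qed.

Lemma heaviside_nondecreasing (R : realType) :
  {homo @heaviside R : a b / a <= b}.
Proof.
move=> a b ab; rewrite /heaviside.
case: (leP 0 a) => a0; first by rewrite (le_trans a0 ab).
by case: ifP.
Qed.

Lemma heaviside_measurable (R : realType) :
  measurable_fun setT (@heaviside R : measurableTypeR R -> measurableTypeR R).
Proof. by apply: nondecreasing_measurable => //; exact: heaviside_nondecreasing. Qed.

Lemma heaviside_itv (R : realType) (z : R) : 0 <= heaviside z <= 1.
Proof. by rewrite /heaviside; case: ifP; rewrite ?lexx ?ler01. Qed.

Lemma step_profile_bounds (R : realType) (N : nat) (m y : 'I_N -> R) (z : R) :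
  (forall i, 0 < m i) -> \sum_(j < N) m j = 1 ->
  - 2^-1 <= step_profile m y z <= 2^-1.
Proof.
move=> hm hm1; rewrite /step_profile.
have s0 : 0 <= \sum_(j < N) m j * heaviside (z - y j).
  apply: sumr_ge0 => j _; apply: mulr_ge0; first exact: ltW.
  by have /andP[] := heaviside_itv (z - y j).
have s1 : \sum_(j < N) m j * heaviside (z - y j) <= 1.
  rewrite -hm1; apply: ler_sum => j _; rewrite ler_piMr ?(ltW (hm j))//.
  by have /andP[] := heaviside_itv (z - y j).
by apply/andP; split; lra.
Qed.

(* The index i : 'I_N is the particle number i + 1, so the affine piece number
   i + 1 is over [theta m i, theta m i.+1]. *)
Theorem theorem4p1 (R : realType) (phi : R -> R) (hphi : protocol phi)
    (N : nat) (m x0 : 'I_N -> R)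
    (hm : forall i, 0 < m i) (hm1 : \sum_(j < N) m j = 1)
    (hx0 : forall i j : 'I_N, (i <= j)%N -> x0 i <= x0 j)
    (A : R -> R)
    (hAcont : {within `[- 2^-1, 2^-1], continuous A})
    (hAaff : forall i : 'I_N, exists a b : R,
        forall y, theta m i <= y <= theta m i.+1 -> A y = a * y + b)
    (psi0 : 'I_N -> R)
    (hpsi0 : forall (i : 'I_N) y,
        theta m i < y < theta m i.+1 -> derive1 A y = psi0 i)
    (v0 : 'I_N -> R)
    (hv0 : forall i,
        v0 i = psi0 i - \sum_(j < N) m j * primitive phi (x0 i - x0 j))
    (x v : 'I_N -> R -> R) (hxv : sticky_dynamics phi m x0 v0 x v) :
  let M := fun y t => step_profile m (fun i => x i t) y in
  let psi := fun (i : 'I_N) t =>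
    v i t + \sum_(j < N) m j * primitive phi (x i t - x j t) in
  [/\ entropy_solution phi A M,
      forall y, M y 0 = step_profile m x0 y
    & forall y t, 0 <= t ->
        A (M y t) =
        A (- 2^-1) + \sum_(i < N) m i * psi i t * heaviside (y - x i t)].
Proof.
have hA2 (i : 'I_N) : A (theta m i.+1) - A (theta m i) = m i * psi0 i.
  have lt : theta m i < theta m i.+1 by rewrite thetaS ltrDl.
  by rewrite (affine_piece_increment lt (hAaff i) (hpsi0 i)) thetaS addrAC subrr add0r.
move=> M psi; split.
- move=> T T0.
  have xc i : continuous (x i \o clamp 0 T).
    by apply: (position_clamp_continuous hxv) => //; exact: ltW.
  have bnd i : exists C, forall t, 0 <= t <= T -> `|(x i \o clamp 0 T) t| <= C.
    exact: continuous_segment_bounded.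
  have [C hC] := choice bnd.
  pose RT := 1 + \sum_(i < N) `|C i|.
  have RT0 : 0 < RT by rewrite /RT ltr_pwDl// sumr_ge0.
  have xRT i t : 0 <= t <= T -> `|x i t| < RT.
    move=> tT; have := hC i t tT; rewrite /= clamp_id// => h.
    rewrite /RT (bigD1 i)//= addrCA; apply: (le_lt_trans h).
    apply: (le_lt_trans (ler_norm (C i))).
    by rewrite ltrDl ltr_pwDl// sumr_ge0.
  split; first by move=> y t _; exact: step_profile_bounds.
  split.
    apply: (@eq_measurable_fun _ _ _ _ _ (fun p : measurableTypeR R * measurableTypeR R =>
      - 2^-1 + \sum_(i < N) m i * heaviside (p.1 - (x i \o clamp 0 T) p.2))).
      move=> p; rewrite inE/= => pT; rewrite /M /step_profile; congr (_ + _).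
      by apply: eq_bigr => i _; rewrite /= clamp_id.
    apply: measurable_funD; first exact: measurable_cst.
    apply: measurable_sum => i; apply: measurable_funM; first exact: measurable_cst.
    apply: measurable_funTS; apply: measurableT_comp; first exact: heaviside_measurable.
    apply: measurable_funB; first exact: measurable_fst.
    apply: measurableT_comp; last exact: measurable_snd.
    exact: continuous_measurable_fun.
  exists RT => //; split.
  + move=> eta q hpair.
    exists (positive_jumps m x eta), (negative_jumps m x eta); split.
      move=> t /andP[t0 _]; exact: (radon_jumps hxv).
    move=> zeta hz c.
    by apply: (entropy_inequality hphi hm hm1 hpsi0 hv0 hxv hpair T0 RT0 _ hz) => i t /xRT/ltW.
  + move=> t _ y z yz; rewrite /M /step_profile lerD2l; apply: ler_sum => i _.
    by rewrite ler_pM2l//; apply: heaviside_nondecreasing; rewrite lerD2r.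
  + move=> y t yR tT; rewrite /M /step_profile; split.
      rewrite (eq_bigr m) ?hm1; first lra.
      move=> i _; rewrite /heaviside subr_ge0 (le_trans (ler_norm _)) ?mulr1//.
      by rewrite (le_trans _ yR)// ltW// xRT.
    rewrite big1 ?addr0// => i _; rewrite /heaviside subr_ge0 leNgt.
    have := xRT i t tT; rewrite ltr_norml => /andP[h _].
    by rewrite (le_lt_trans _ h) ?mulr0// lerN2.
- by move=> y; rewrite /M; congr (_ + _); apply: eq_bigr => i _; rewrite (sticky_init_pos hxv).
- by move=> y t t0; exact: (flux_of_profile hphi hm hA2 hv0 hxv).
Qed.
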